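(* The surface $\Sigma=\{(x,y,z)\in E(1,1): e^z y+e^{-z}x=0\}$ is stable.
   Context: $E(1,1)$ denotes $\mathbb{R}^3$ with coordinates $(x,y,z)$ and the left-invariant vector fields $X=\partial_z$, $Y=\frac{1}{\sqrt2}(-e^{z}\partial_x+e^{-z}\partial_y)$, $T=\frac{1}{\sqrt2}(e^{z}\partial_x+e^{-z}\partial_y)$, with the Riemannian metric $\langle\cdot,\cdot\rangle$ making $\{X,Y,T\}$ orthonormal. The horizontal distribution is $\mathcal{H}=\mathrm{span}\{X,Y\}$. For a surface $\Sigma$ with Riemannian unit normal $N$, $N_h$ is the orthogonal projection of $N$ onto $\mathcal{H}$. The sub-Riemannian area is $A(\Sigma)=\int_\Sigma|N_h|\,d\Sigma$, with $d\Sigma$ the Riemannian area element. An area-stationary surface (critical point of $A$ under compactly supported deformations) is stable if the second derivative of the area at $0$ is nonnegative for every compactly supported variation. *)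

(* Defs.v *)
From HB Require Import structures.
From mathcomp Require Import all_boot all_order all_algebra.
From mathcomp Require Import all_classical all_reals all_analysis.
From mathcomp Require Import ring.

Set Implicit Arguments.
Unset Strict Implicit.
Unset Printing Implicit Defensive.

Import Order.TTheory GRing.Theory Num.Theory.
Import numFieldNormedType.Exports.

Local Open Scope classical_set_scope.
Local Open Scope ring_scope.

(* C^k on an open set U, for maps between finite-dimensional spaces: there,
   this is equivalent to existence and continuity of all partial derivatives of
   order at most k. *)
Fixpoint Ck (R : realType) (V W : normedModType R) (k : nat) (U : set V)
    (f : V -> W) : Prop :=
  match k with
  | 0 => forall x, U x -> {for x, continuous f}
  | k'.+1 => (forall x, U x -> differentiable f x) /\
             (forall v : V, Ck k' U (fun x => 'D_v f x))
  end.

Section E11.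
Variable R : realType.

(* Triples stand both for points (x, y, z) and for tangent vectors, the latter
   by their components on d/dx, d/dy, d/dz. *)
Local Notation R2 := (R * R)%type.
Local Notation R3 := (R * R * R)%type.
Implicit Types p v w a b : R3.

Definition cx p : R := p.1.1.
Definition cy p : R := p.1.2.
Definition cz p : R := p.2.

Definition frameX p : R3 := (0, 0, 1).
Definition frameY p : R3 :=
  (- expR (cz p) / Num.sqrt 2, expR (- cz p) / Num.sqrt 2, 0).
Definition frameT p : R3 :=
  (expR (cz p) / Num.sqrt 2, expR (- cz p) / Num.sqrt 2, 0).

(* The coframe dual to X, Y, T: see frame_decomp and metric_orthonormal. *)
Definition coX p v : R := cz v.
Definition coY p v : R :=
  (- expR (- cz p) * cx v + expR (cz p) * cy v) / Num.sqrt 2.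
Definition coT p v : R :=
  (expR (- cz p) * cx v + expR (cz p) * cy v) / Num.sqrt 2.

Definition metric p v w : R :=
  coX p v * coX p w + coY p v * coY p w + coT p v * coT p w.

Definition mnorm p v : R := Num.sqrt (metric p v v).

Lemma sqrt2_neq0 : Num.sqrt 2 != 0 :> R.
Proof. by rewrite sqrtr_eq0 -ltNge ltr0n. Qed.

Lemma sqrt2_sqr : Num.sqrt 2 * Num.sqrt 2 = 2 :> R.
Proof. by rewrite -expr2 sqr_sqrtr ?ler0n. Qed.

Lemma frame_decomp p v :
  v = coX p v *: frameX p + coY p v *: frameY p + coT p v *: frameT p.
Proof.
case: p v => -[x y] z [[a b] c].
rewrite /frameX /frameY /frameT /coX /coY /coT /cx /cy /cz /= expRN.
have s0 := sqrt2_neq0; have s2 := sqrt2_sqr.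
have e0 : expR z != 0 by rewrite gt_eqF ?expR_gt0.
have h (u w : R) : u = 2 * w / (Num.sqrt 2 * Num.sqrt 2) -> w = u.
  by rewrite s2 => ->; field.
congr (_, _, _) => /=; rewrite /GRing.scale /=; last by ring.
- by apply: h; field; rewrite s0 e0.
- by apply: h; field; rewrite s0 e0.
Qed.

Lemma metric_orthonormal p :
  [/\ metric p (frameX p) (frameX p) = 1, metric p (frameY p) (frameY p) = 1
    & metric p (frameT p) (frameT p) = 1] /\
  [/\ metric p (frameX p) (frameY p) = 0, metric p (frameX p) (frameT p) = 0
    & metric p (frameY p) (frameT p) = 0].
Proof.
case: p => -[x y] z.
rewrite /metric /frameX /frameY /frameT /coX /coY /coT /cx /cy /cz /= expRN.
have s0 := sqrt2_neq0; have s2 := sqrt2_sqr.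
have e0 : expR z != 0 by rewrite gt_eqF ?expR_gt0.
have h (u : R) :
    u = 4 / (Num.sqrt 2 * Num.sqrt 2 * (Num.sqrt 2 * Num.sqrt 2)) -> u = 1.
  by rewrite s2 => ->; field.
by split; split; (try by field; rewrite ?s0 ?e0); apply: h; field;
  rewrite ?s0 ?e0.
Qed.

(* The vector product of a and b for the metric, oriented by (X, Y, T). *)
Definition cross p a b : R3 :=
  (coY p a * coT p b - coT p a * coY p b) *: frameX p +
  (coT p a * coX p b - coX p a * coT p b) *: frameY p +
  (coX p a * coY p b - coY p a * coX p b) *: frameT p.

(* N, for a surface with tangent plane spanned by a and b at p. *)
Definition unit_normal p a b : R3 :=
  (mnorm p (cross p a b))^-1 *: cross p a b.

Definition hproj p v : R3 :=
  metric p v (frameX p) *: frameX p + metric p v (frameY p) *: frameY p.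

(* dSigma = area_element du dv, if a and b are the two partial derivatives of
   the parametrization. *)
Definition area_element p a b : R :=
  Num.sqrt (metric p a a * metric p b b - metric p a b ^+ 2).

(* The integral of |N_h| dSigma over the image of D under the parametrization
   F : R^2 -> R^3. *)
Definition subriemannian_area (F : R2 -> R3) (D : set R2) : \bar R :=
  (\int[lebesgue_measure \x lebesgue_measure]_(q in D)
     (let a := 'D_((1, 0) : R2) F q in
      let b := 'D_((0, 1) : R2) F q in
      mnorm (F q) (hproj (F q) (unit_normal (F q) a b))
        * area_element (F q) a b)%:E)%E.

(* F is a C^2 parametrization of the surface S by the whole plane: an immersion
   and a homeomorphism onto S. *)
Definition parametrizes (F : R2 -> R3) (S : set R3) : Prop :=
  [/\ Ck 2 setT F,
      (forall q (h : R2), 'D_h F q = 0 -> h = 0),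
      range F = S
    & exists G : R3 -> R2, cancel F G /\ {within S, continuous G}].

Definition C2_diffeomorphism (f : R3 -> R3) : Prop :=
  Ck 2 setT f /\ exists g, [/\ cancel f g, cancel g f & Ck 2 setT g].

(* phi t, for |t| < e, is a deformation of R^3 supported in the compact set K. *)
Definition compact_variation (e : R) (K : set R3) (phi : R -> R3 -> R3) : Prop :=
  [/\ 0 < e, compact K,
      Ck 2 [set tp : R * R3 | `|tp.1| < e] (fun tp => phi tp.1 tp.2),
      (forall p, phi 0 p = p)
    & forall t, `|t| < e ->
        C2_diffeomorphism (phi t) /\ (forall p, ~ K p -> phi t p = p)].

(* t |-> A(phi_t(S `&` K)), where F parametrizes S. The part of S outside K is
   not moved; it is left out because its area may be infinite. *)
Definition area_along (F : R2 -> R3) (K : set R3) (phi : R -> R3 -> R3)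
    (t : R) : R :=
  fine (subriemannian_area (phi t \o F) (F @^-1` K)).

Definition stationary_param (F : R2 -> R3) : Prop :=
  forall e K phi, compact_variation e K phi ->
    is_derive (0 : R) 1 (area_along F K phi) 0.

(* liminf of 2 (A t - A 0 - t A'(0)) / t^2 as t -> 0, t != 0; by Taylor's
   formula this is A''(0) as soon as A is twice differentiable at 0. *)
Definition lower_second_derivative (A : R -> R) : \bar R :=
  lime_inf (fun t => (2 * (A t - A 0 - t * derive1 A 0) / t ^+ 2)%:E) 0.

(* A deformation moving the singular set {N_h = 0} can make A fail to be twice
   differentiable at 0 (typically A''(0) = +oo).  The second clause makes the
   condition meaningful for these deformations too; it contains the first. *)
Definition second_derivative_ge0 (A : R -> R) : Prop :=
  ((\forall t \near (0 : R), derivable A t 1) -> derivable (derive1 A) 0 1 ->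
     0 <= derive1n 2 A 0) /\
  (0 <= lower_second_derivative A)%E.

Definition stable_param (F : R2 -> R3) : Prop :=
  stationary_param F /\
  forall e K phi, compact_variation e K phi ->
    second_derivative_ge0 (area_along F K phi).

(* Stability of a surface S diffeomorphic to the plane. By the change of
   variables formula, the choice of the parametrization is irrelevant. *)
Definition stable (S : set R3) : Prop :=
  exists F, parametrizes F S /\ stable_param F.

Definition Sigma : set R3 :=
  [set p | expR (cz p) * cy p + expR (- cz p) * cx p = 0].

End E11.

(* Main.v *)
Require Import Defs.
From mathcomp Require Import all_boot all_order all_algebra.
From mathcomp Require Import all_classical all_reals all_analysis.
From mathcomp Require Import measurable_realfun ring lra.

Set Implicit Arguments.
Unset Strict Implicit.
Unset Printing Implicit Defensive.

Import Order.TTheory GRing.Theory Num.Theory.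
Import numFieldNormedType.Exports.

Local Open Scope classical_set_scope.
Local Open Scope ring_scope.

(** The surface is area-minimizing, not merely stable, because it is calibrated.

Sigma is ruled by the integral lines of Y through the z-axis: the map
F(s, z) = exp of s Y from (0, 0, z) parametrizes it, with F_s = Y and
F_z = X - s T.  A normal vector is therefore - s X - T, so that
|N_h| dSigma = |s| ds dz, and the horizontal unit normal - sgn(s) X jumps along
the z-axis, which is the singular set.  On Sigma the sign of s is that of y - x.
The horizontal field - sgn(y - x) X extends the horizontal normal to the whole
space; it has norm at most 1 and, as X = d/dz while y - x does not depend on z,
its divergence vanishes even across the plane y = x.  Hence its flux through a
surface is unchanged by a compactly supported deformation, is at most the
sub-Riemannian area, and equals the area for Sigma itself: the area along every
deformation is minimal at time 0 ([calibration], [area_minimizing]).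

The flux of a field g(y - x) d/dz is the integral of g(y - x) dy /\ dx.  To stay
within smooth functions the sign is replaced by u / sqrt(u^2 + e^2), whose
primitive is sqrt(u^2 + e^2), and e tends to 0.  The pulled-back 2-form is then
exact, and the invariance of its integral ([flux_eq]) needs only Fubini, the
one-variable fundamental theorem and the symmetry of second partial derivatives;
no derivative in time is taken.

Minimality does not give stationarity, since the area could have a corner at 0.
The area density is sqrt(P^2 + Q^2) with P, Q of class C^1 in time, and
P^2 + Q^2 = s^2 at time 0: off the null set s = 0 it is differentiable at time 0,
and it is Lipschitz in time everywhere.  By dominated convergence
A(t) + A(-t) - 2 A(0) = o(t) ([second_difference_cvg0]); at a minimum this
bounds A(t) - A(0), which is thus o(t).  The conditions on the second derivative
then follow from minimality alone. *)

(** * Maps of class C^k *)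

Section CkCalculus.
Variable R : realType.

Lemma near_eq_differentiable (V W : normedModType R) (f g : V -> W) (x : V) :
  {near x, f =1 g} -> differentiable f x -> differentiable g x.
Proof.
move=> fg /diff_locallyP[df fE].
have gE : g \o shift x = cst (g x) + 'd f x +o_ 0 id.
  apply/eqaddoP => e e0; move/eqaddoP: fE => /(_ e e0) fE.
  have fg' : \forall h \near (0 : V), f (h + x) = g (h + x).
    have : h + x @[h --> (0 : V)] --> x.
      by rewrite -[X in _ --> X]add0r; apply: cvgD; [exact: cvg_id|exact: cvg_cst].
    by move=> /(_ _ fg).
  near=> h; rewrite -(nbhs_singleton fg).
  have -> : (g \o shift x - (cst (f x) + 'd f x)) h =
            (f \o shift x - (cst (f x) + 'd f x)) h.
    by rewrite !fctE /=; congr (_ - _); symmetry; near: h.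
  by near: h.
apply/diff_locallyP; rewrite (diff_unique df gE); split => //.
Unshelve. all: by end_near. Qed.

Lemma derive_congr (V W : normedModType R) (U : set V) (f g : V -> W) v :
  open U -> (forall q, U q -> f q = g q) -> forall q, U q -> 'D_v f q = 'D_v g q.
Proof.
move=> Uo fg q Uq; apply: near_eq_derive.
by near=> y; apply: fg; near: y; exact: open_nbhs_nbhs.
Unshelve. all: by end_near. Qed.

(** The formulas for derivatives of sums, products and composites hold on U only,
    so each closure property below passes through this congruence. *)
Lemma Ck_ext (V W : normedModType R) k (U : set V) (f g : V -> W) :
  open U -> (forall x, U x -> f x = g x) -> Ck k U f -> Ck k U g.
Proof.
move=> Uo; elim: k f g => [|k IH] f g fg.
  move=> fc x Ux; rewrite /prop_for /continuous_at -(fg _ Ux).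
  apply: cvg_trans (fc x Ux); apply: near_eq_cvg.
  by near=> y; apply/fg; near: y; exact: open_nbhs_nbhs.
have fgn x : U x -> {near x, f =1 g}.
  by move=> Ux; near=> y; apply/fg; near: y; exact: open_nbhs_nbhs.
move=> [fd fD]; split=> [x Ux|v].
  exact: near_eq_differentiable (fgn _ Ux) (fd _ Ux).
by apply: IH (fD v); exact: derive_congr.
Unshelve. all: by end_near. Qed.

Lemma Ck_continuous (V W : normedModType R) k (U : set V) (f : V -> W) :
  Ck k U f -> forall x, U x -> {for x, continuous f}.
Proof.
case: k => [//|k] [fd _] x Ux; exact: differentiable_continuous (fd x Ux).
Qed.

Lemma Ck_differentiable (V W : normedModType R) k (U : set V) (f : V -> W) x :
  Ck k.+1 U f -> U x -> differentiable f x.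
Proof. by move=> [fd _]; exact: fd. Qed.

Lemma Ck_derive (V W : normedModType R) k (U : set V) (f : V -> W) v :
  Ck k.+1 U f -> Ck k U ('D_v f).
Proof. by move=> [_]; exact. Qed.

Lemma CkW (V W : normedModType R) k (U : set V) (f : V -> W) :
  Ck k.+1 U f -> Ck k U f.
Proof.
elim: k f => [|k IH] f; first exact: Ck_continuous.
by move=> [fd fD]; split => // v; apply: IH; exact: fD.
Qed.

Lemma Ck_sub (V W : normedModType R) k (U U' : set V) (f : V -> W) :
  U `<=` U' -> Ck k U' f -> Ck k U f.
Proof.
move=> UU'; elim: k f => [|k IH] f; first by move=> fc x /UU'; exact: fc.
by move=> [fd fD]; split => [x /UU'|v]; [exact: fd|exact/IH/fD].
Qed.

Lemma Ck_cst (V W : normedModType R) k (U : set V) (c : W) : Ck k U (fun _ : V => c).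
Proof.
elim: k c => [|k IH] c; first by move=> x _; exact: cst_continuous.
split=> [x _|v]; first exact: differentiable_cst.
have -> : 'D_v (fun _ : V => c) = fun _ => 0 by apply/funext => x; rewrite derive_cst.
exact: IH.
Qed.

Lemma Ck_lin (V W : normedModType R) k (U : set V) (f : {linear V -> W}) :
  continuous f -> Ck k U f.
Proof.
move=> fc; case: k => [x _|k]; first exact: fc.
split=> [x _|v]; first exact: linear_differentiable.
have -> : 'D_v f = fun _ => f v; last exact: Ck_cst.
apply/funext => x; rewrite deriveE ?diff_lin //; exact: linear_differentiable.
Qed.

Lemma CkD (V W : normedModType R) k (U : set V) (f g : V -> W) : open U ->
  Ck k U f -> Ck k U g -> Ck k U (fun x => f x + g x).
Proof.
move=> Uo; elim: k f g => [|k IH] f g.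
  by move=> fc gc x Ux; apply: cvgD; [exact: fc|exact: gc].
move=> [fd fD] [gd gD]; split=> [x Ux|v].
  by apply: differentiableD; [exact: fd|exact: gd].
apply: Ck_ext (IH _ _ (fD v) (gD v)) => // x Ux.
by rewrite -deriveD //; apply/diff_derivable; [exact: fd|exact: gd].
Qed.

Lemma Ck_sum (V W : normedModType R) k (U : set V) n (f : 'I_n -> V -> W) :
  open U -> (forall i, Ck k U (f i)) -> Ck k U (fun x => \sum_(i < n) f i x).
Proof.
move=> Uo; elim: n f => [|n IH] f fC.
  by under [X in Ck _ _ X]eq_fun do rewrite big_ord0; exact: Ck_cst.
under [X in Ck _ _ X]eq_fun do rewrite big_ord_recr /=.
by apply: CkD => //; apply: IH => i; exact: fC.
Qed.

Lemma CkM (V : normedModType R) k (U : set V) (f g : V -> R) : open U ->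
  Ck k U f -> Ck k U g -> Ck k U (fun x => f x * g x).
Proof.
move=> Uo; elim: k f g => [|k IH] f g.
  by move=> fc gc x Ux; apply: cvgM; [exact: fc|exact: gc].
move=> fC gC; have [[fd fD] [gd gD]] := (fC, gC); split=> [x Ux|v].
  by apply: differentiableM; [exact: fd|exact: gd].
apply: Ck_ext (CkD Uo (IH _ _ (CkW fC) (gD v)) (IH _ _ (CkW gC) (fD v))) => // x Ux.
by rewrite -[RHS]/('D_v (f * g) x) deriveM //; apply/diff_derivable; [exact: fd|exact: gd].
Qed.

Lemma CkN (V : normedModType R) k (U : set V) (f : V -> R) : open U ->
  Ck k U f -> Ck k U (fun x => - f x).
Proof.
move=> Uo fC; apply: Ck_ext (CkM Uo (@Ck_cst _ _ k U (-1 : R)) fC) => // x _.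
by rewrite mulN1r.
Qed.

Lemma CkB (V : normedModType R) k (U : set V) (f g : V -> R) : open U ->
  Ck k U f -> Ck k U g -> Ck k U (fun x => f x - g x).
Proof. by move=> Uo fC gC; apply: CkD => //; exact: CkN. Qed.

Lemma derive_comp (V W Z : normedModType R) (f : V -> W) (g : W -> Z) (x v : V) :
  differentiable f x -> differentiable g (f x) ->
  'D_v (g \o f) x = 'd g (f x) ('D_v f x).
Proof.
move=> fd gd; rewrite !deriveE //; last exact: differentiable_comp.
by rewrite diff_comp.
Qed.

Lemma derive_comp1 (V : normedModType R) (f : V -> R) (g : R -> R) (dg : R) (x v : V) :
  differentiable f x -> is_derive (f x) 1 g dg ->
  'D_v (g \o f) x = dg * 'D_v f x.
Proof.
move=> fd [gd <-].
have gd' : differentiable g (f x) by exact/derivable1_diffP.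
by rewrite derive_comp // deriv1E // derive1E -[LHS]/(_ * _) mulrC.
Qed.

Lemma Ck_expR (V : normedModType R) k (U : set V) (f : V -> R) : open U ->
  Ck k U f -> Ck k U (fun x => expR (f x)).
Proof.
move=> Uo; elim: k => [|k IH].
  move=> fc x Ux; apply: (@continuous_comp _ _ _ f expR); first exact: fc.
  exact: continuous_expR.
move=> fC; have [fd fD] := fC; split=> [x Ux|v].
  apply: (@differentiable_comp _ _ _ _ f expR); first exact: fd.
  exact/derivable1_diffP.
apply: Ck_ext (CkM Uo (IH (CkW fC)) (fD v)) => // x Ux.
by rewrite -[RHS]/('D_v (expR \o f) x) (@derive_comp1 _ _ _ (expR (f x)))//; exact: fd.
Qed.

Lemma derive_pair (V W Z : normedModType R) (f : V -> W) (g : V -> Z) (x v : V) :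
  differentiable f x -> differentiable g x ->
  'D_v (fun y => (f y, g y)) x = ('D_v f x, 'D_v g x).
Proof.
move=> fd gd; rewrite !deriveE //; last exact: differentiable_pair.
by rewrite diff_pair.
Qed.

Lemma Ck_pair (V W Z : normedModType R) k (U : set V) (f : V -> W) (g : V -> Z) :
  open U -> Ck k U f -> Ck k U g -> Ck k U (fun x => (f x, g x)).
Proof.
move=> Uo; elim: k f g => [|k IH] f g.
  by move=> fc gc x Ux; apply: cvg_pair; [exact: fc|exact: gc].
move=> [fd fD] [gd gD]; split=> [x Ux|v].
  by apply: differentiable_pair; [exact: fd|exact: gd].
apply: Ck_ext (IH _ _ (fD v) (gD v)) => // x Ux.
by rewrite derive_pair //; [exact: fd|exact: gd].
Qed.

Lemma derive_fst (V W Z : normedModType R) (f : V -> W * Z) (x v : V) :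
  differentiable f x -> 'D_v (fun y => (f y).1) x = ('D_v f x).1.
Proof.
have c : continuous (fst : W * Z -> W) by move=> p; exact: cvg_fst.
move=> fd; rewrite -[LHS]/('D_v (fst \o f) x) derive_comp //; last exact: linear_differentiable.
by rewrite diff_lin.
Qed.

Lemma derive_snd (V W Z : normedModType R) (f : V -> W * Z) (x v : V) :
  differentiable f x -> 'D_v (fun y => (f y).2) x = ('D_v f x).2.
Proof.
have c : continuous (snd : W * Z -> Z) by move=> p; exact: cvg_snd.
move=> fd; rewrite -[LHS]/('D_v (snd \o f) x) derive_comp //; last exact: linear_differentiable.
by rewrite diff_lin.
Qed.

Lemma Ck_fst (V W Z : normedModType R) k (U : set V) (f : V -> W * Z) :
  open U -> Ck k U f -> Ck k U (fun x => (f x).1).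
Proof.
move=> Uo; elim: k f => [|k IH] f.
  by move=> fc x Ux; apply: (@continuous_comp _ _ _ f fst); [exact: fc|exact: cvg_fst].
move=> [fd fD]; split=> [x Ux|v].
  apply: (@differentiable_comp _ _ _ _ f fst); first exact: fd.
  by apply: linear_differentiable => p; exact: cvg_fst.
by apply: Ck_ext (IH _ (fD v)) => // x Ux; rewrite derive_fst //; exact: fd.
Qed.

Lemma Ck_snd (V W Z : normedModType R) k (U : set V) (f : V -> W * Z) :
  open U -> Ck k U f -> Ck k U (fun x => (f x).2).
Proof.
move=> Uo; elim: k f => [|k IH] f.
  by move=> fc x Ux; apply: (@continuous_comp _ _ _ f snd); [exact: fc|exact: cvg_snd].
move=> [fd fD]; split=> [x Ux|v].
  apply: (@differentiable_comp _ _ _ _ f snd); first exact: fd.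
  by apply: linear_differentiable => p; exact: cvg_snd.
by apply: Ck_ext (IH _ (fD v)) => // x Ux; rewrite derive_snd //; exact: fd.
Qed.

Lemma Ck_id (V : normedModType R) k (U : set V) : Ck k U (fun x : V => x).
Proof. by apply: (@Ck_lin _ _ k U idfun) => x; exact: cvg_id. Qed.

Lemma Ck_first (V : normedModType R) k (U : set (R * V)) :
  Ck k U (fun q : R * V => q.1).
Proof. by apply: (@Ck_lin _ _ k U fst) => p; exact: cvg_fst. Qed.

Lemma Ck_second (V : normedModType R) k (U : set (V * R)) :
  Ck k U (fun q : V * R => q.2).
Proof. by apply: (@Ck_lin _ _ k U snd) => p; exact: cvg_snd. Qed.

Lemma Ck1_comp (V : normedModType R) (U : set V) (f : V -> R) (H h : R -> R) :
  open U -> (forall x : R, is_derive x (1 : R) H (h x)) -> continuous h ->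
  Ck 1 U f -> Ck 1 U (H \o f).
Proof.
move=> Uo dH ch [fd fD]; split=> [x Ux|v].
  apply: differentiable_comp; first exact: fd.
  by apply/derivable1_diffP; have [] := dH (f x).
apply: (@Ck_ext _ _ 0 _ (fun x => h (f x) * 'D_v f x)) => // [x Ux|].
  by rewrite (@derive_comp1 _ _ _ (h (f x))) //; exact: fd.
apply: CkM => //; last exact: fD.
move=> x Ux; apply: (@continuous_comp _ _ _ f h).
  exact: differentiable_continuous (fd x Ux).
exact: ch.
Qed.

(** [basis4] and [coord4] expand a direction of time x space in a basis: in the
    chain rule the direction in which the outer map is differentiated varies with
    the point, whereas [Ck] speaks of fixed directions. *)
Definition basis4 : 'I_4 -> R * (R * R * R) :=
  tnth [tuple (1, (0, 0, 0)); (0, (1, 0, 0)); (0, (0, 1, 0)); (0, (0, 0, 1))].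

Definition coord4 (i : 'I_4) (w : R * (R * R * R)) : R :=
  tnth [tuple w.1; w.2.1.1; w.2.1.2; w.2.2] i.

Lemma coord4E w : w = \sum_(i < 4) coord4 i w *: basis4 i.
Proof.
rewrite !big_ord_recl big_ord0 /coord4 /basis4 !(tnth_nth 0) /=.
case: w => [t [[x y] z]].
by congr (_, (_, _, _)) => /=; rewrite !scaler0 ?scale0r;
  rewrite /GRing.scale /= ?mulr1 ?mulr0 ?addr0 ?add0r.
Qed.

Lemma Ck_coord4 (V : normedModType R) k (U : set V) (f : V -> R * (R * R * R)) i :
  open U -> Ck k U f -> Ck k U (fun x => coord4 i (f x)).
Proof.
move=> Uo fC; move: i; case=> -[|[|[|[|//]]]] ?; rewrite /coord4 /=;
  under [X in Ck _ _ X]eq_fun do rewrite (tnth_nth 0) /=.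
- exact: Ck_fst.
- by do 2 apply: Ck_fst => //; exact: Ck_snd.
- by apply: Ck_snd => //; apply: Ck_fst => //; exact: Ck_snd.
- by apply: Ck_snd => //; exact: Ck_snd.
Qed.

(** By the chain rule and [coord4E], the derivative of the composite is a sum of
    products of C^k functions with composites of partial derivatives of g, to
    which the induction hypothesis applies. *)
Lemma Ck_comp (V : normedModType R) k (U : set V) (U' : set (R * (R * R * R)))
    (f : V -> R * (R * R * R)) (g : R * (R * R * R) -> R) :
  open U -> (forall x, U x -> U' (f x)) ->
  Ck k U f -> Ck k U' g -> Ck k U (fun x => g (f x)).
Proof.
move=> Uo fU; elim: k f fU g => [|k IH] f fU g.
  move=> fC gC x Ux; apply: (@continuous_comp _ _ _ f g); first exact: fC.
  exact/gC/fU.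
move=> fC [gd gD]; have [fd fD] := fC; split=> [x Ux|v].
  apply: (@differentiable_comp _ _ _ _ f g); first exact: fd.
  exact/gd/fU.
have E x : U x -> \sum_(i < 4) coord4 i ('D_v f x) * 'D_(basis4 i) g (f x) =
     'D_v (fun x => g (f x)) x.
  move=> Ux; have gdx := gd _ (fU _ Ux).
  rewrite -[RHS]/('D_v (g \o f) x) [RHS]derive_comp //; last exact: fd.
  rewrite [in RHS](coord4E ('D_v f x)) linear_sum; apply: eq_bigr => i _.
  by rewrite linearZ (deriveE _ gdx).
apply: (Ck_ext Uo E).
have t i : Ck k U (fun x => coord4 i ('D_v f x) * 'D_(basis4 i) g (f x)).
  apply: CkM => //; first by apply: Ck_coord4 => //; exact: fD.
  exact: (IH f fU ('D_(basis4 i) g) (CkW fC) (gD _)).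
exact: Ck_sum.
Qed.

End CkCalculus.

(** * Slices and mixed partial derivatives *)

Section Slices.
Variable R : realType.
Local Notation R2 := (R * R)%type.
Local Notation "'e1'" := ((1, 0) : R2).
Local Notation "'e2'" := ((0, 1) : R2).

Let slice1E (V V' : normedModType R) (h : R) (x v : V) (y : V') :
  h *: ((v, 0) : V * V') + (x, y) = (h *: v + x, y).
Proof. by congr (_, _) => /=; rewrite scaler0 add0r. Qed.

Let slice2E (V V' : normedModType R) (h : R) (x : V) (y v : V') :
  h *: ((0, v) : V * V') + (x, y) = (x, h *: v + y).
Proof. by congr (_, _) => /=; rewrite scaler0 add0r. Qed.

Lemma derive_slice1 (V V' W : normedModType R) (g : V * V' -> W) x y v :
  derive (fun s => g (s, y)) x v = 'D_((v, 0) : V * V') g (x, y).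
Proof.
rewrite /derive; congr (lim (_ @ 0^')); apply/funext => h /=.
by rewrite slice1E.
Qed.

Lemma derive_slice2 (V V' W : normedModType R) (g : V * V' -> W) x y v :
  derive (fun s => g (x, s)) y v = 'D_((0, v) : V * V') g (x, y).
Proof.
rewrite /derive; congr (lim (_ @ 0^')); apply/funext => h /=.
by rewrite slice2E.
Qed.

Lemma derivable_slice1 (V V' W : normedModType R) (g : V * V' -> W) x y v :
  derivable g (x, y) (v, 0) -> derivable (fun s => g (s, y)) x v.
Proof.
rewrite /derivable => gd; rewrite (_ : (fun h => _) = fun h : R =>
  h^-1 *: ((g \o shift (x, y)) (h *: (v, 0)) - g (x, y))) //.
by apply/funext => h /=; rewrite slice1E.
Qed.

Lemma derivable_slice2 (V V' W : normedModType R) (g : V * V' -> W) x y v :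
  derivable g (x, y) (0, v) -> derivable (fun s => g (x, s)) y v.
Proof.
rewrite /derivable => gd; rewrite (_ : (fun h => _) = fun h : R =>
  h^-1 *: ((g \o shift (x, y)) (h *: (0, v)) - g (x, y))) //.
by apply/funext => h /=; rewrite slice2E.
Qed.

Lemma Ck_slice2 (V V' W : normedModType R) k (U : set (V * V')) (g : V * V' -> W) x :
  Ck k U g -> Ck k [set y | U (x, y)] (fun y => g (x, y)).
Proof.
have pair_diff (y : V') : differentiable (fun y : V' => (x, y)) y.
  by apply: differentiable_pair.
elim: k g => [|k IH] g gC.
  move=> y Uy; apply: (@continuous_comp _ _ _ (fun y => (x, y)) g); last exact: gC.
  exact: differentiable_continuous.
split=> [y Uy|v].
  apply: (@differentiable_comp _ _ _ _ (fun y => (x, y)) g) => //.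
  exact: (Ck_differentiable gC).
have -> : 'D_v (fun y => g (x, y)) = fun y => 'D_(0, v) g (x, y).
  by apply/funext => y; rewrite derive_slice2.
exact: (IH _ (Ck_derive _ gC)).
Qed.

Lemma MVT_derivable (f : R -> R) (a b : R) : a < b ->
  (forall x : R, derivable f x 1) ->
  exists2 c : R, a < c < b & f b - f a = 'D_1 f c * (b - a).
Proof.
move=> ab fd; have [] := @MVT _ f ('D_1 f) a b ab.
- by move=> x _; exact/derivableP.
- by apply: derivable_within_continuous => x _; exact: fd.
by move=> c; rewrite in_itv /= => cab E; exists c.
Qed.

(** Schwarz's theorem: the second difference of g over a square of side h is, by
    the mean value theorem applied in either order, h^2 times either mixed
    derivative at some point of the square. *)
Lemma partial_commute (g : R2 -> R) q : Ck 2 setT g ->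
  'D_e1 ('D_e2 g) q = 'D_e2 ('D_e1 g) q.
Proof.
move=> gC; case: q => x y.
have D1g v p : derivable g p v.
  by apply: diff_derivable; exact: (Ck_differentiable gC).
have D2g v w p : derivable ('D_v g) p w.
  by apply: diff_derivable; exact: (Ck_differentiable (Ck_derive v gC)).
have cA := Ck_continuous (Ck_derive e1 (Ck_derive e2 gC)) (I : setT (x, y)).
have cB := Ck_continuous (Ck_derive e2 (Ck_derive e1 gC)) (I : setT (x, y)).
(* On a small square at (x, y) both mixed derivatives are within e / 2 of their values
   at (x, y), and some value of one there equals some value of the other. *)
apply/eqP; rewrite -subr_eq0 -normr_le0; apply/ler_addgt0Pl => e e0; rewrite addr0.
have e20 : 0 < e / 2 by rewrite divr_gt0.
move/cvgrPdist_le : cA => /(_ _ e20)/nbhs_ballP[d1 /= d10 A1].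
move/cvgrPdist_le : cB => /(_ _ e20)/nbhs_ballP[d2 /= d20 B2].
pose h := Num.min d1 d2 / 2.
have m0 : 0 < Num.min d1 d2 by rewrite lt_min d10 d20.
have h0 : 0 < h by rewrite divr_gt0.
have hm : h < Num.min d1 d2 by rewrite ltr_pdivrMr // ltr_pMr // ltr1n.
have [hd1 hd2] : h < d1 /\ h < d2 by move: hm; rewrite lt_min => /andP[].
have near_ball (d a b s t : R) : h < d -> a < s < a + h -> b < t < b + h ->
    ball ((a, b) : R2) d (s, t).
  move=> hd /andP[s1 s2] /andP[t1 t2]; split; rewrite /ball /= ltr_norml;
    by apply/andP; split; lra.
have xh : x < x + h by rewrite ltrDl.
have yh : y < y + h by rewrite ltrDl.
pose D := g (x + h, y + h) - g (x, y + h) - (g (x + h, y) - g (x, y)).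
have [s0 s0x [t0 t0y DB]] : exists2 s0, x < s0 < x + h & exists2 t0, y < t0 < y + h &
    D = 'D_e2 ('D_e1 g) (s0, t0) * h * h.
  have fd (s : R) : derivable (fun s => g (s, y + h) - g (s, y)) s 1.
    by apply: derivableB; exact: (derivable_slice1 (D1g e1 _)).
  have [s0 s0x E] := MVT_derivable xh fd; exists s0; first exact: s0x.
  have [|t0 t0y E'] := @MVT_derivable (fun t => 'D_e1 g (s0, t)) _ _ yh.
    by move=> t; exact: (derivable_slice2 (D2g e1 e2 (s0, t))).
  exists t0; first exact: t0y; rewrite -(derive_slice2 ('D_e1 g)).
  have -> : D = g (x + h, y + h) - g (x + h, y) - (g (x, y + h) - g (x, y)).
    by rewrite /D; ring.
  rewrite E [x + h - x]addrC addKr; congr (_ * h).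
  rewrite deriveB; [|exact: (derivable_slice1 (D1g e1 _))..].
  by rewrite !derive_slice1 E' [y + h - y]addrC addKr.
have [t1 t1y [s1 s1x DA]] : exists2 t1, y < t1 < y + h & exists2 s1, x < s1 < x + h &
    D = 'D_e1 ('D_e2 g) (s1, t1) * h * h.
  have fd (t : R) : derivable (fun t => g (x + h, t) - g (x, t)) t 1.
    by apply: derivableB; exact: (derivable_slice2 (D1g e2 _)).
  have [t1 t1y E] := MVT_derivable yh fd; exists t1; first exact: t1y.
  have [|s1 s1x E'] := @MVT_derivable (fun s => 'D_e2 g (s, t1)) _ _ xh.
    by move=> s; exact: (derivable_slice1 (D2g e2 e1 (s, t1))).
  exists s1; first exact: s1x; rewrite -(derive_slice1 ('D_e2 g)).
  rewrite /D E [y + h - y]addrC addKr; congr (_ * h).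
  rewrite deriveB; [|exact: (derivable_slice2 (D1g e2 _))..].
  by rewrite !derive_slice2 E' [x + h - x]addrC addKr.
have AB : 'D_e1 ('D_e2 g) (s1, t1) = 'D_e2 ('D_e1 g) (s0, t0).
  by move: DB; rewrite DA => /(mulIf (lt0r_neq0 h0))/(mulIf (lt0r_neq0 h0)).
rewrite -[X in `|X|](subrKA ('D_e1 ('D_e2 g) (s1, t1))) [leRHS]splitr.
apply: le_trans (ler_normD _ _) _; apply: lerD.
  by apply: A1; exact: near_ball.
by rewrite AB distrC; apply: B2; exact: near_ball.
Qed.

End Slices.

(** * Integration over the plane *)

Section PlaneMeasure.
Variable R : realType.
Local Notation mu := (@lebesgue_measure R).
Local Notation mu2 := (mu \x mu)%E.

(** The product sigma-algebra contains the open sets of the plane: each of them is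
    a countable union of boxes with rational centres and radii. *)
Lemma open_measurable2 (A : set (R * R)) :
  open A -> measurable (A : set (measurableTypeR R * measurableTypeR R)).
Proof.
move=> oA.
pose B (p : (rat * rat) * (rat * rat)) : set (R * R) :=
  ball (ratr p.1.1 : R) (ratr p.1.2) `*` ball (ratr p.2.1 : R) (ratr p.2.2).
have -> : A = \bigcup_p (if pselect (B p `<=` A) then B p else set0).
  apply/seteqP; split=> [x Ax|x [p _]]; last by case: pselect => [BA /BA//|_ []].
  have /nbhs_ballP[e e0 xeA] := open_nbhs_nbhs (conj oA Ax).
  have open_ball1 (y : R) : y \in (ball y e : set R) by rewrite inE; exact: ballxx.
  have [c1 [r1 /= [/set_mem x1 B1]]] := open_subball_rat (ball_open x.1 e) (open_ball1 x.1).
  have [c2 [r2 /= [/set_mem x2 B2]]] := open_subball_rat (ball_open x.2 e) (open_ball1 x.2).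
  exists ((c1, r1), (c2, r2)) => //; case: pselect => [_|] //=.
  by case=> y /= [y1 y2]; apply: xeA; split; [exact: B1|exact: B2].
apply: countable_bigcupT_measurable => [|p]; first exact: countableP.
case: pselect => /= ?; last exact: measurable0.
by apply: measurableX; apply: open_measurable; exact: ball_open.
Qed.

Lemma closed_measurable2 (A : set (R * R)) :
  closed A -> measurable (A : set (measurableTypeR R * measurableTypeR R)).
Proof. by move/closed_openC/open_measurable2/measurableC; rewrite setCK. Qed.

Lemma continuous_measurable_fun2 (f : R * R -> R) : continuous f ->
  measurable_fun setT (f : measurableTypeR R * measurableTypeR R -> R).
Proof.
move=> /continuousP cf; apply: (measurability _ (RGenOpens.measurableE R)).
move=> _ [_ [a [b ->] <-]]; rewrite setTI; apply: open_measurable2.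
exact/cf/interval_open.
Qed.

Definition box (r : R) : set (R * R) := [set q | `|q.1| <= r /\ `|q.2| <= r].

Lemma boxE r : box r = `[- r, r] `*` `[- r, r].
Proof.
by apply/seteqP; split=> -[x y]; rewrite /box /= !in_itv /= -!ler_norml.
Qed.

Lemma compact_box r : compact (box r).
Proof. by rewrite boxE; apply: compact_setX; exact: segment_compact. Qed.

Lemma closed_box r : closed (box r).
Proof. apply: compact_closed; [exact: norm_hausdorff|exact: compact_box]. Qed.

Lemma box_fin r : (mu2 (box r) < +oo)%E.
Proof.
rewrite boxE product_measure1E /=; [|exact: measurable_itv|exact: measurable_itv].
by rewrite lebesgue_measure_itv /=; case: ifPn => _; rewrite ?mule0 // -EFinM ltry.
Qed.

Lemma continuous_integrable2 (D : set (R * R)) r (f : R * R -> R) :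
  closed D -> D `<=` box r -> continuous f -> mu2.-integrable D (EFin \o f).
Proof.
move=> cD Dr cf; have mD := closed_measurable2 cD.
apply: measurable_bounded_integrable => //.
- apply: le_lt_trans (box_fin r); apply: le_measure; rewrite ?inE //.
  exact: closed_measurable2 (@closed_box r).
- by apply: measurable_funS (continuous_measurable_fun2 cf).
have : compact (f @` box r).
  by apply: continuous_compact; [exact: continuous_subspaceT|exact: compact_box].
move/compact_bounded => [M [Mr fM]]; exists M; split => // N MN x Dx /=.
by apply: fM MN _ _; exists x => //; exact: Dr.
Qed.

Lemma vanish_derive (V W : normedModType R) (U : set V) (g : V -> W) v :
  open U -> (forall q, U q -> g q = 0) -> forall q, U q -> 'D_v g q = 0.
Proof. by move=> Uo g0 q Uq; rewrite (derive_congr v Uo g0) // derive_cst. Qed.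

(** The divergence theorem for compactly supported fields, in dimension one and
    then, by Fubini, for each of the two partial derivatives in the plane. *)
Lemma integral_derive1_0 (g dg : R -> R) (r : R) :
  (forall x : R, is_derive x (1 : R) g (dg x)) -> continuous dg ->
  (forall x : R, r < `|x| -> g x = 0 /\ dg x = 0) ->
  (\int[mu]_x (dg x)%:E = 0)%E.
Proof.
move=> gd cdg g0; pose a : R := `|r| + 1.
have a0 : 0 < a by rewrite ltr_wpDl.
have ra : r < a by rewrite (le_lt_trans (ler_norm _)) // ltrDl.
have gdx x : derivable g x 1 by have [] := gd x.
have cg : continuous g.
  by move=> x; apply/differentiable_continuous/derivable1_diffP.
rewrite [LHS](_ : _ = \int[mu]_(x in `[(- a)%R, a]) (dg x)%:E)%E.
  rewrite (@continuous_FTC2 _ dg g) //.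
  - by rewrite (g0 a _).1 ?(g0 (- a) _).1 ?normrN ?gtr0_norm ?subee.
  - by rewrite gtrN.
  - exact: continuous_subspaceT.
  - split=> [x _//||]; [apply: cvg_at_right_filter|apply: cvg_at_left_filter]; exact: cg.
  - by move=> x _; rewrite derive1E; exact: derive_val.
rewrite [RHS]integral_mkcond; apply: eq_integral => x _; rewrite patchE.
case: ifPn => // /negP; rewrite inE /= in_itv /= -ler_norml => /negP.
by rewrite -ltNge => /(lt_trans ra)/g0[_ ->].
Qed.

Lemma box_integrable (h : R * R -> R) r : continuous h ->
  (forall q, ~ box r q -> h q = 0) -> mu2.-integrable setT (EFin \o h).
Proof.
move=> ch h0.
have := continuous_integrable2 (@closed_box r) (@subset_refl _ _) ch.
move/(integrable_mkcond _ (closed_measurable2 (@closed_box r))).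
congr (_.-integrable _ _); apply/funext => q; rewrite patchE.
by case: ifPn => // /negP; rewrite inE /= => /h0 ->.
Qed.

Lemma box_lt (r x y : R) : r < `|x| \/ r < `|y| -> ~ box r (x, y).
Proof. by move=> + [/= x1 x2]; rewrite !ltNge x1 x2 => -[]. Qed.

Lemma integral_partial1_0 (g : R * R -> R) r :
  (forall q, derivable g q (1, 0)) -> continuous ('D_((1, 0) : R * R) g) ->
  (forall q, ~ box r q -> g q = 0) ->
  (\int[mu2]_q ('D_((1, 0) : R * R) g q)%:E = 0)%E.
Proof.
move=> gd cg g0.
have h0 q : ~ box r q -> 'D_((1, 0) : R * R) g q = 0.
  by apply: (@vanish_derive _ _ (~` box r)) => //; exact/closed_openC/closed_box.
rewrite -integral21_prod_meas1; last exact: box_integrable h0.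
have E y : (\int[mu]_x ('D_((1, 0) : R * R) g (x, y))%:E = 0)%E.
  apply: (@integral_derive1_0 (fun x => g (x, y)) _ r).
  - move=> x; apply: DeriveDef; first exact: derivable_slice1.
    by rewrite derive_slice1.
  - move=> x; apply: (@continuous_comp _ _ _ (fun x => (x, y)) ('D_((1, 0) : R * R) g)).
      by apply: (@cvg_pair _ _ _ (nbhs x) (nbhs x) (nbhs y) _ _ _ id (cst y));
        [exact: cvg_id|exact: cvg_cst].
    exact: cg.
  - by move=> x rx; split; [apply: g0|apply: h0]; apply: box_lt; left.
by rewrite (eq_integral (cst 0%E)) ?integral0 // => y _; rewrite -(E y).
Qed.

Lemma integral_partial2_0 (g : R * R -> R) r :
  (forall q, derivable g q (0, 1)) -> continuous ('D_((0, 1) : R * R) g) ->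
  (forall q, ~ box r q -> g q = 0) ->
  (\int[mu2]_q ('D_((0, 1) : R * R) g q)%:E = 0)%E.
Proof.
move=> gd cg g0.
have h0 q : ~ box r q -> 'D_((0, 1) : R * R) g q = 0.
  by apply: (@vanish_derive _ _ (~` box r)) => //; exact/closed_openC/closed_box.
rewrite -integral12_prod_meas1; last exact: box_integrable h0.
have E x : (\int[mu]_y ('D_((0, 1) : R * R) g (x, y))%:E = 0)%E.
  apply: (@integral_derive1_0 (fun y => g (x, y)) _ r).
  - move=> y; apply: DeriveDef; first exact: derivable_slice2.
    by rewrite derive_slice2.
  - move=> y; apply: (@continuous_comp _ _ _ (fun y => (x, y)) ('D_((0, 1) : R * R) g)).
      by apply: (@cvg_pair _ _ _ (nbhs y) (nbhs x) (nbhs y) _ _ _ (cst x) id);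
        [exact: cvg_cst|exact: cvg_id].
    exact: cg.
  - by move=> y rx; split; [apply: g0|apply: h0]; apply: box_lt; right.
by rewrite (eq_integral (cst 0%E)) ?integral0 // => x _; rewrite -(E x).
Qed.

End PlaneMeasure.

(** * Calibration *)

Section Flux.
Variable R : realType.
Local Notation R2 := (R * R)%type.
Local Notation mu := (@lebesgue_measure R).
Local Notation mu2 := (mu \x mu)%E.
Local Notation "'e1'" := ((1, 0) : R2).
Local Notation "'e2'" := ((0, 1) : R2).

(** The density of the 2-form df /\ dy. *)
Definition jac (f y : R2 -> R) (q : R2) : R :=
  'D_e1 f q * 'D_e2 y q - 'D_e1 y q * 'D_e2 f q.

(** The 2-form h(f) df /\ dy is the differential of H(f) dy.  In terms of
    derivatives: the mixed second derivatives of y cancel. *)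
Lemma flux_div (f y : R2 -> R) (H h : R -> R) q :
  Ck 2 setT f -> Ck 2 setT y -> (forall x : R, is_derive x (1 : R) H (h x)) ->
  h (f q) * jac f y q =
  'D_e1 (fun p => H (f p) * 'D_e2 y p) q - 'D_e2 (fun p => H (f p) * 'D_e1 y p) q.
Proof.
move=> fC yC dH.
have dHf p : differentiable (H \o f) p.
  apply: differentiable_comp; first exact: (Ck_differentiable fC).
  by apply/derivable1_diffP; have [] := dH (f p).
have DHf v : 'D_v (H \o f) q = h (f q) * 'D_v f q.
  by rewrite (@derive_comp1 _ _ _ _ (h (f q))) //; exact: (Ck_differentiable fC).
have dy v p : differentiable ('D_v y) p by exact: (Ck_differentiable (Ck_derive v yC)).
rewrite -[X in _ = X - _]/('D_e1 ((H \o f) * 'D_e2 y) q).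
rewrite -[X in _ = _ - X]/('D_e2 ((H \o f) * 'D_e1 y) q).
rewrite !deriveM; try exact: diff_derivable.
rewrite !DHf (partial_commute _ yC) /jac /= /GRing.scale /=; ring.
Qed.

(** The difference of the two primitives H(f1) dy1 - H(f0) dy0 has compact support,
    so its differential integrates to 0. *)
Lemma flux_eq (f0 y0 f1 y1 : R2 -> R) (H h : R -> R) (r : R) :
  Ck 2 setT f0 -> Ck 2 setT y0 -> Ck 2 setT f1 -> Ck 2 setT y1 ->
  (forall x : R, is_derive x (1 : R) H (h x)) -> continuous h ->
  (forall q, ~ box r q -> f1 q = f0 q) -> (forall q, ~ box r q -> y1 q = y0 q) ->
  (\int[mu2]_q (h (f1 q) * jac f1 y1 q - h (f0 q) * jac f0 y0 q)%:E = 0)%E.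
Proof.
move=> f0C y0C f1C y1C dH ch f01 y01.
have oT : open [set: R2] by exact: openT.
have Uo : open (~` box r) by apply: closed_openC; exact: closed_box.
pose M v q := H (f1 q) * 'D_v y1 q - H (f0 q) * 'D_v y0 q.
have MC v : Ck 1 setT (M v).
  apply: CkB => //; apply: CkM => //; try exact: Ck_derive.
  - exact: (Ck1_comp oT dH ch (CkW f1C)).
  - exact: (Ck1_comp oT dH ch (CkW f0C)).
have dM v w q : derivable (M v) q w.
  by apply: diff_derivable; exact: (Ck_differentiable (MC v)).
have cM v w : continuous ('D_w (M v)).
  by move=> q; exact: (Ck_continuous (Ck_derive w (MC v)) (I : setT q)).
have M0 v q : ~ box r q -> M v q = 0.
  move=> nq; rewrite /M f01 // (_ : 'D_v y1 q = 'D_v y0 q) ?subrr //.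
  by apply: (derive_congr _ Uo).
have DM0 v w q : ~ box r q -> 'D_w (M v) q = 0.
  by apply: (@vanish_derive _ _ _ (~` box r)) => //; exact: M0.
have key (a b c d : R) : a - b - (c - d) = a - c - (b - d) by ring.
have E q : h (f1 q) * jac f1 y1 q - h (f0 q) * jac f0 y0 q =
    'D_e1 (M e2) q - 'D_e2 (M e1) q.
  rewrite (@flux_div _ _ H) // (@flux_div f0 y0 H) //.
  have d (f y : R2 -> R) v w : Ck 2 setT f -> Ck 2 setT y ->
      derivable (fun p => H (f p) * 'D_v y p) q w.
    move=> fC yC; apply: diff_derivable.
    apply: (@differentiableM _ _ (H \o f) ('D_v y));
      last exact: (Ck_differentiable (Ck_derive v yC)).
    apply: differentiable_comp; first exact: (Ck_differentiable fC).
    by apply/derivable1_diffP; have [] := dH (f q).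
  rewrite ['D_e1 (M _) q]deriveB; [|exact: d..].
  rewrite ['D_e2 (M _) q]deriveB; [|exact: d..].
  by apply: key.
under eq_integral => q _ do rewrite E EFinB.
rewrite integralB //; last 2 first.
- by apply: (@box_integrable _ _ r); [exact: cM|exact: DM0].
- by apply: (@box_integrable _ _ r); [exact: cM|exact: DM0].
have I1 := integral_partial1_0 (dM e2 e1) (cM e2 e1) (M0 e2).
have I2 := integral_partial2_0 (dM e1 e2) (cM e1 e2) (M0 e1).
by rewrite [X in (X - _)%E]I1 [X in (_ - X)%E]I2 sube0.
Qed.

End Flux.

Section Calibration.
Variable R : realType.
Local Notation R2 := (R * R)%type.
Local Notation mu := (@lebesgue_measure R).
Local Notation mu2 := (mu \x mu)%E.
Local Notation "'e1'" := ((1, 0) : R2).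
Local Notation "'e2'" := ((0, 1) : R2).

(** A smooth substitute for the absolute value; its derivative [soft_sign] stands
    for the sign in the calibrating field. *)
Definition soft_abs (e x : R) : R := Num.sqrt (x ^+ 2 + e ^+ 2).
Definition soft_sign (e x : R) : R := x / soft_abs e x.

Lemma soft_abs_gt0 e x : 0 < e -> 0 < soft_abs e x.
Proof. by move=> e0; rewrite sqrtr_gt0 ltr_wpDl ?sqr_ge0 ?exprn_gt0. Qed.

Lemma soft_absE e x : soft_abs e x ^+ 2 = x ^+ 2 + e ^+ 2.
Proof. by rewrite sqr_sqrtr // addr_ge0 ?sqr_ge0. Qed.

Lemma is_derive_soft_abs (e x : R) : 0 < e ->
  is_derive x (1 : R) (soft_abs e) (soft_sign e x).
Proof.
move=> e0.
have p0 : 0 < x ^+ 2 + e ^+ 2 by rewrite ltr_wpDl ?sqr_ge0 ?exprn_gt0.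
have d1 : is_derive x (1 : R) (fun x : R => x ^+ 2 + e ^+ 2) (2 * x).
  apply: is_derive_eq; rewrite /GRing.scale /=; ring.
have := is_derive1_comp (g := fun x : R => x ^+ 2 + e ^+ 2) (f := Num.sqrt)
  (is_derive1_sqrt p0) d1.
rewrite -/(soft_abs e x) /soft_sign.
have s0 := soft_abs_gt0 x e0.
rewrite (_ : (2 * soft_abs e x)^-1 * _ = x / soft_abs e x) //.
by field; rewrite lt0r_neq0.
Qed.

Lemma continuous_soft_sign e : 0 < e -> continuous (soft_sign e).
Proof.
move=> e0 x; apply: cvgM; first exact: cvg_id.
apply: cvgV; first by rewrite lt0r_neq0 // soft_abs_gt0.
have [d _] := is_derive_soft_abs x e0.
by apply/differentiable_continuous/derivable1_diffP.
Qed.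

Lemma soft_sign_le1 e x : 0 < e -> `|soft_sign e x| <= 1.
Proof.
move=> e0; have s0 := soft_abs_gt0 x e0.
rewrite normrM normfV (gtr0_norm s0) ler_pdivrMr // mul1r.
by rewrite -sqrtr_sqr ler_wsqrtr // lerDl sqr_ge0.
Qed.

(** The loss incurred on the original surface by smoothing the sign: it is at most e
    pointwise because the calibrating function x dominates s. *)
Lemma soft_sign_ge e x s : 0 < e -> 0 <= s * x -> `|s| <= `|x| ->
  `|s| - e <= soft_sign e x * s.
Proof.
move=> e0 sx0 sx; have s0 := soft_abs_gt0 x e0.
have -> : soft_sign e x * s = `|s| * `|x| / soft_abs e x.
  by rewrite -normrM (ger0_norm sx0) /soft_sign mulrAC mulrC [x * s]mulrC mulrC.
have le_abs : soft_abs e x <= `|x| + e.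
  rewrite -(ler_pXn2r (n := 2)) ?nnegrE ?(ltW s0) ?addr_ge0 ?(ltW e0) //.
  rewrite soft_absE sqrrD real_normK ?num_real // -addrA lerD2l lerDr.
  by rewrite mulrn_wge0 // mulr_ge0 // ltW.
rewrite ler_pdivlMr // mulrBl lerBlDr.
have ge_x : `|x| <= soft_abs e x.
  by rewrite -sqrtr_sqr ler_wsqrtr // lerDl sqr_ge0.
apply: (le_trans (ler_wpM2l (normr_ge0 s) le_abs)); rewrite mulrDr lerD2l mulrC.
by rewrite ler_wpM2l ?(ltW e0) // (le_trans sx).
Qed.

(** dy /\ dx = d(y - x) /\ dy, a form whose product with a function of y - x is
    covered by [flux_eq]. *)
Lemma jac_shear (X Y : R2 -> R) q : derivable X q e1 -> derivable X q e2 ->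
  derivable Y q e1 -> derivable Y q e2 -> jac (fun p => Y p - X p) Y q = jac Y X q.
Proof.
move=> X1 X2 Y1 Y2; rewrite /jac.
rewrite -[in LHS](_ : Y - X = fun p => Y p - X p) // !deriveB //.
by rewrite !mulrBl !mulrBr opprB addrACA addrC subrKA; ring.
Qed.

Lemma jac_continuous (f g : R2 -> R) : Ck 2 setT f -> Ck 2 setT g -> continuous (jac f g).
Proof.
move=> fC gC q; have oT : open [set: R2] by exact: openT.
have d (k : R2 -> R) v (kC : Ck 2 setT k) : Ck 0 setT ('D_v k) := CkW (Ck_derive v kC).
have C : Ck 0 setT (jac f g).
  by apply: CkB => //; apply: CkM => //; exact: d.
exact: (Ck_continuous C).
Qed.

(** X0, Y0 are the coordinates x, y along the surface and X1, Y1 those along its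
    deformation; q.1 is s.  The flux of - soft_sign(y - x) d/dz is the same through both; it
    is at most the integral of I1 through the second, and at least that of |s| - e
    through the first. *)
Lemma calibration (X0 Y0 X1 Y1 I1 : R2 -> R) (D : set R2) (r : R) :
  closed D -> D `<=` box r ->
  Ck 2 setT X0 -> Ck 2 setT Y0 -> Ck 2 setT X1 -> Ck 2 setT Y1 ->
  (forall q, ~ D q -> X1 q = X0 q) -> (forall q, ~ D q -> Y1 q = Y0 q) ->
  (forall q, jac Y0 X0 q = - q.1) ->
  (forall q, 0 <= q.1 * (Y0 q - X0 q)) -> (forall q, `|q.1| <= `|Y0 q - X0 q|) ->
  continuous I1 -> (forall q, `|jac Y1 X1 q| <= I1 q) ->
  (\int[mu2]_(q in D) `|q.1| <= \int[mu2]_(q in D) I1 q)%R.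
Proof.
move=> cD Dr X0C Y0C X1C Y1C X01 Y01 J0 pos dom cI1 JI1.
have oT : open [set: R2] by exact: openT.
have mD := closed_measurable2 cD.
pose f0 q := Y0 q - X0 q; pose f1 q := Y1 q - X1 q.
have f0C : Ck 2 setT f0 by exact: CkB.
have f1C : Ck 2 setT f1 by exact: CkB.
have der (k : R2 -> R) q v (kC : Ck 2 setT k) : derivable k q v :=
  diff_derivable (Ck_differentiable kC (I : setT q)).
have Jf0 q : jac f0 Y0 q = - q.1 by rewrite jac_shear ?J0 //; exact: der.
have Jf1 q : jac f1 Y1 q = jac Y1 X1 q by rewrite jac_shear //; exact: der.
have cI0 : continuous (fun q : R2 => `|q.1|).
  by move=> q; apply: (@cvg_norm _ R^o); exact: cvg_fst.
have iI0 := continuous_integrable2 cD Dr cI0.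
have iI1 := continuous_integrable2 cD Dr cI1.
rewrite -subr_ge0 -RintegralB //.
pose m := fine (mu2 D).
have m0 : 0 <= m by exact: fine_ge0.
apply/ler_addgt0Pl => e' e'0; rewrite -[leLHS]oppr0.
(* The smoothing costs e times the measure m of D; m may be 0, whence m + 1. *)
pose e := e' / (m + 1).
have e0 : 0 < e by rewrite divr_gt0 // ltr_wpDl.
have em : e * m <= e' by rewrite /e mulrAC ler_pdivrMr ?ltr_wpDl // ler_pM2l // lerDl.
pose G q := - soft_sign e (f1 q) * jac f1 Y1 q - - soft_sign e (f0 q) * jac f0 Y0 q.
have cG : continuous G.
  have c (f y : R2 -> R) : Ck 2 setT f -> Ck 2 setT y ->
      continuous (fun q => - soft_sign e (f q) * jac f y q).
    move=> fC yC q; apply: cvgM; last exact: jac_continuous.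
    apply: cvgN; apply: (@continuous_comp _ _ _ f (soft_sign e)).
      exact: (Ck_continuous fC).
    exact: continuous_soft_sign.
  by move=> q; apply: cvgB; exact: c.
have G0 : (\int[mu2]_q (G q)%:E = 0)%E.
  apply: (@flux_eq _ f0 Y0 f1 Y1 (fun x => - soft_abs e x) (fun x => - soft_sign e x) r) => //.
  - by move=> x; apply: is_deriveN; exact: is_derive_soft_abs.
  - by move=> x; apply: cvgN; exact: continuous_soft_sign.
  - by move=> q nq; rewrite /f1 X01 ?Y01 // => /Dr.
  - by move=> q nq; rewrite Y01 // => /Dr.
have GD : \int[mu2]_(q in D) G q = 0.
  rewrite /Rintegral integral_mkcond -[RHS]/(fine 0%E) -G0; congr fine.
  apply: eq_integral => q _; rewrite patchE; case: ifPn => // /negP; rewrite inE => nDq.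
  have oD : open (~` D) by exact: closed_openC.
  have f10 p : ~ D p -> f1 p = f0 p by move=> nDp; rewrite /f1 X01 ?Y01.
  rewrite /G f10 // (_ : jac f1 Y1 q = jac f0 Y0 q) ?subrr //.
  by rewrite /jac !(derive_congr _ oD f10) // !(derive_congr _ oD Y01).
have iG := continuous_integrable2 cD Dr cG.
have iS : mu2.-integrable D (EFin \o (fun q => I1 q - `|q.1|)).
  by apply: (continuous_integrable2 cD Dr) => q; apply: cvgB; [exact: cI1|exact: cI0].
have ie : mu2.-integrable D (EFin \o (fun=> e)).
  by apply: (continuous_integrable2 cD Dr) => q; exact: cvg_cst.
have : \int[mu2]_(q in D) G q <= \int[mu2]_(q in D) ((I1 q - `|q.1|) + e).
  apply: le_Rintegral => //.
    apply: (continuous_integrable2 cD Dr) => q.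
    by apply: cvgD; [apply: cvgB; [exact: cI1|exact: cI0]|exact: cvg_cst].
  move=> q Dq; rewrite /G Jf0 Jf1 mulrNN.
  have h1 : - soft_sign e (f1 q) * jac Y1 X1 q <= I1 q.
    apply: le_trans (ler_norm _) _; rewrite normrM normrN.
    apply: le_trans (JI1 q); rewrite -[leRHS]mul1r.
    by rewrite ler_wpM2r // soft_sign_le1.
  have h2 := soft_sign_ge e0 (pos q) (dom q).
  by move: h1 h2; rewrite -/(f0 q); lra.
rewrite GD RintegralD // Rintegral_cst // -/m oppr0 => le0.
by apply: le_trans le0 _; rewrite addrC lerD2r.
Qed.

End Calibration.

(** * Second differences of the area *)

Section SecondDifference.
Variable R : realType.
Local Notation R2 := (R * R)%type.
Local Notation mu := (@lebesgue_measure R).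
Local Notation mu2 := (mu \x mu)%E.

(** The even combination of g kills the derivative, so the quotient tends to 0,
    which is also its value at t = 0 by the convention on division. *)
Lemma second_difference_continuous (g : R -> R) : derivable g 0 1 ->
  {for 0, continuous (fun t => (g t + g (- t) - 2 * g 0) / t)}.
Proof.
move=> gd; apply/continuous_withinNx; rewrite invr0 mulr0.
(* k vanishes at 0 together with its derivative. *)
pose k t := g t + g (- t) - 2 * g 0.
have dN : is_derive (0 : R) (1 : R) (fun t => g (- t)) (- 'D_1 g 0).
  have g0 : is_derive (- 0 : R) (1 : R) g ('D_1 g 0) by rewrite oppr0; exact/derivableP.
  have := is_derive1_comp g0 (is_deriveNid (0 : R) 1).
  by rewrite mulrN1.
have dk : is_derive (0 : R) (1 : R) k 0.
  have d0 := derivableP gd.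
  have := is_deriveB (is_deriveD d0 dN) (is_derive_cst (2 * g 0 : R) (0 : R) (1 : R)).
  by rewrite subrr subr0.
have k0 : k 0 = 0 by rewrite /k oppr0; ring.
have [dk1 dk2] := dk; rewrite -[X in _ --> X]dk2.
rewrite [X in X @ _](_ : _ = fun h : R => h^-1 *: ((k \o shift 0) (h *: 1) - k 0)).
  exact: dk1.
by apply/funext => h /=; rewrite k0 subr0 addr0 /GRing.scale /= mulr1 mulrC.
Qed.

Lemma lipschitz_at0 (g : R -> R) (a C : R) :
  (forall x, `|x| <= a -> derivable g x 1) ->
  (forall x, `|x| <= a -> `|'D_1 g x| <= C) ->
  forall x, `|x| <= a -> `|g x - g 0| <= C * `|x|.
Proof.
move=> gd gC x xa.
have sub u v (y : R) : - `|x| <= u -> v <= `|x| -> y \in `[u, v] -> `|y| <= a.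
  move=> xu vx; rewrite in_itv /= => /andP[uy yv]; apply: le_trans xa.
  by rewrite ler_norml (le_trans xu uy) (le_trans yv vx).
have mvt u v : u <= v -> - `|x| <= u -> v <= `|x| -> `|g v - g u| <= C * (v - u).
  move=> uv xu vx; have [] := @MVT_segment _ g ('D_1 g) u v uv.
  - move=> y /subset_itv_oo_cc yuv; apply/derivableP; apply: gd; exact: (sub u v).
  - by apply: derivable_within_continuous => y yuv; apply: gd; exact: (sub u v).
  move=> c cuv ->; rewrite normrM (@ger0_norm _ (v - u)) ?subr_ge0 //.
  by rewrite ler_wpM2r ?subr_ge0 // gC //; exact: (sub u v).
have [x0|x0] := leP 0 x.
  by have := mvt 0 x x0; rewrite ger0_norm // subr0; apply; rewrite ?oppr_le0.
have := mvt x 0 (ltW x0); rewrite distrC ltr0_norm // sub0r; apply; rewrite ?opprK //.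
by rewrite oppr_ge0 ltW.
Qed.

(** The Euclidean norm of the plane is 1-Lipschitz for the l^1 norm; unlike its
    derivative, this bound is available at the origin, that is, on the singular
    set. *)
Lemma sqrt_sum_lipschitz (x y x' y' : R) :
  `|Num.sqrt (x ^+ 2 + y ^+ 2) - Num.sqrt (x' ^+ 2 + y' ^+ 2)| <= `|x - x'| + `|y - y'|.
Proof.
wlog H : x y x' y' / Num.sqrt (x' ^+ 2 + y' ^+ 2) <= Num.sqrt (x ^+ 2 + y ^+ 2).
  move=> W; have [|/ltW] := leP (Num.sqrt (x' ^+ 2 + y' ^+ 2)) (Num.sqrt (x ^+ 2 + y ^+ 2)).
    exact: W.
  by move/W; rewrite distrC (distrC x') (distrC y').
rewrite ger0_norm ?subr_ge0 // lerBlDl.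
set r := Num.sqrt (x' ^+ 2 + y' ^+ 2).
have r0 : 0 <= r by exact: sqrtr_ge0.
have r2 : r ^+ 2 = x' ^+ 2 + y' ^+ 2 by rewrite sqr_sqrtr // addr_ge0 ?sqr_ge0.
have xr : `|x'| <= r by rewrite -sqrtr_sqr ler_wsqrtr // lerDl sqr_ge0.
have yr : `|y'| <= r by rewrite -sqrtr_sqr ler_wsqrtr // lerDr sqr_ge0.
set a := `|x - x'|; set b := `|y - y'|.
have a0 : 0 <= a by exact: normr_ge0.
have b0 : 0 <= b by exact: normr_ge0.
have xa : `|x| <= `|x'| + a by rewrite -[x in `|x|](subrKC x') ler_normD.
have yb : `|y| <= `|y'| + b by rewrite -[y in `|y|](subrKC y') ler_normD.
rewrite -(ler_pXn2r (n := 2)) ?nnegrE ?sqrtr_ge0 ?addr_ge0 //.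
rewrite sqr_sqrtr ?addr_ge0 ?sqr_ge0 //.
have x2 : x ^+ 2 <= (`|x'| + a) ^+ 2.
  by rewrite -(real_normK (num_real x)) ler_pXn2r ?nnegrE ?addr_ge0.
have y2 : y ^+ 2 <= (`|y'| + b) ^+ 2.
  by rewrite -(real_normK (num_real y)) ler_pXn2r ?nnegrE ?addr_ge0.
apply: (le_trans (lerD x2 y2)).
rewrite !sqrrD !real_normK ?num_real //.
have h1 : `|x'| * a <= r * a by rewrite ler_wpM2r.
have h2 : `|y'| * b <= r * b by rewrite ler_wpM2r.
have h3 : 0 <= a * b by rewrite mulr_ge0.
rewrite !mulr2n r2 mulrDr; move: h1 h2 h3; rewrite !expr2; lra.
Qed.

Lemma ae_first_neq0 : {ae mu2, forall q, q.1 != 0 :> R}.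
Proof.
exists ([set 0] `*` setT); split.
- by apply: measurableX => //; exact: measurable_set1.
- by rewrite product_measure1E //= lebesgue_measure_set1 mul0e.
by move=> q /= /negP; rewrite negbK => /eqP.
Qed.

(** The time interval is halved to make it compact inside the domain of P. *)
Lemma time_derivative_bounded (P : R * R2 -> R) (e r : R) : 0 < e ->
  Ck 1 [set x : R * R2 | `|x.1| < e] P ->
  exists C, forall t q, `|t| <= e / 2 -> box r q -> `|'D_(1, 0) P (t, q)| <= C.
Proof.
move=> e0 PC; pose K : set (R * R2) := `[- (e / 2), e / 2] `*` box r.
have cK : compact K by apply: compact_setX; [exact: segment_compact|exact: compact_box].
have : compact ('D_(1, 0) P @` K).
  apply: continuous_compact cK; apply: continuous_in_subspaceT => x /set_mem[x1 _].
  refine (Ck_continuous (Ck_derive ((1, 0) : R * R2) PC) _).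
  move: x1; rewrite /= in_itv /= -ler_norml => /le_lt_trans; apply.
  by rewrite ltr_pdivrMr // ltr_pMr // ltr1n.
move/compact_bounded => [M [Mr PM]]; exists (M + 1) => t q te rq.
apply: PM; rewrite ?ltrDl //; exists (t, q) => //; split => //=.
by rewrite in_itv /= -ler_norml.
Qed.

(** Dominated convergence for the difference quotients, dominated thanks to the
    Lipschitz bound and converging to 0 wherever the density is positive at time 0,
    hence almost everywhere. *)
Lemma second_difference_cvg0 (P Q : R * R2 -> R) (D : set R2) (e r : R) : 0 < e ->
  Ck 1 [set x : R * R2 | `|x.1| < e] P -> Ck 1 [set x : R * R2 | `|x.1| < e] Q ->
  closed D -> D `<=` box r ->
  (forall q, q.1 != 0 -> 0 < P (0, q) ^+ 2 + Q (0, q) ^+ 2) ->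
  let A t := (\int[mu2]_(q in D) Num.sqrt (P (t, q) ^+ 2 + Q (t, q) ^+ 2))%R in
  (A t + A (- t) - 2 * A 0) / t @[t --> 0] --> 0.
Proof.
move=> e0 PC QC cD Dr pos A; pose U : set (R * R2) := [set x : R * R2 | `|x.1| < e].
pose I t q := Num.sqrt (P (t, q) ^+ 2 + Q (t, q) ^+ 2).
have mD := closed_measurable2 cD.
have cI x : U x -> {for x, continuous (fun x => I x.1 x.2)}.
  move=> Ux; have cP := Ck_continuous PC Ux; have cQ := Ck_continuous QC Ux.
  have -> : (fun x => I x.1 x.2) = Num.sqrt \o (fun x => P x * P x + Q x * Q x).
    by apply/funext => -[t q]; rewrite /I /= !expr2.
  apply: continuous_comp; last exact: sqrt_continuous.
  by apply: cvgD; apply: cvgM.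
have cIq t : `|t| < e -> continuous (I t).
  move=> te q; apply: (@continuous_comp _ _ _ (fun q => (t, q)) (fun x => I x.1 x.2)).
    by apply: (@cvg_pair _ _ _ (nbhs q) (nbhs t) (nbhs q) _ _ _ (cst t) id);
      [exact: cvg_cst|exact: cvg_id].
  exact: cI.
have cIt q t : `|t| < e -> {for t, continuous (I ^~ q)}.
  move=> te; apply: (@continuous_comp _ _ _ (fun t => (t, q)) (fun x => I x.1 x.2)).
    by apply: (@cvg_pair _ _ _ (nbhs t) (nbhs t) (nbhs q) _ _ _ id (cst q));
      [exact: cvg_id|exact: cvg_cst].
  exact: cI.
pose f t q := (I t q + I (- t) q - 2 * I 0 q) / t.
have iI t : `|t| < e -> mu2.-integrable D (EFin \o I t).
  by move=> te; apply: (continuous_integrable2 cD Dr); exact: cIq.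
have cf t : `|t| < e -> continuous (f t).
  move=> te q; apply: cvgM; last exact: cvg_cst.
  apply: cvgB; first by apply: cvgD; apply: cIq; rewrite ?normrN.
  by apply: cvgM; [exact: cvg_cst|apply: cIq; rewrite normr0].
have intf t : `|t| < e -> mu2.-integrable D (EFin \o f t).
  by move=> te; apply: (continuous_integrable2 cD Dr); exact: cf.
have Ae t : `|t| < e -> \int[mu2]_(q in D) f t q = (A t + A (- t) - 2 * A 0) / t.
  move=> te; have tN : `|- t| < e by rewrite normrN.
  have z : `|0 : R| < e by rewrite normr0.
  have i2 : mu2.-integrable D (EFin \o (fun q => 2 * I 0 q)).
    apply: (continuous_integrable2 cD Dr) => q.
    by apply: cvgM; [exact: cvg_cst|exact: cIq].
  have iD : mu2.-integrable D (EFin \o (fun q => I t q + I (- t) q)).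
    by apply: (continuous_integrable2 cD Dr) => q; apply: cvgD; exact: cIq.
  rewrite /f RintegralZr //; last first.
    by apply: (continuous_integrable2 cD Dr) => q; apply: cvgB;
      [apply: cvgD; exact: cIq|apply: cvgM; [exact: cvg_cst|exact: cIq]].
  by rewrite RintegralB // RintegralD // ?RintegralZl //; exact: iI.
have [C1 bP] := time_derivative_bounded r e0 PC.
have [C2 bQ] := time_derivative_bounded r e0 QC.
have e2 : e / 2 < e by rewrite ltr_pdivrMr // ltr_pMr // ltr1n.
have e20 : 0 < e / 2 by rewrite divr_gt0.
have lip (g : R * R2 -> R) C t q : Ck 1 U g ->
    (forall t q, `|t| <= e / 2 -> box r q -> `|'D_(1, 0) g (t, q)| <= C) ->
    `|t| <= e / 2 -> D q -> `|g (t, q) - g (0, q)| <= C * `|t|.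
  move=> gC bg te Dq; apply: (@lipschitz_at0 (fun t => g (t, q)) (e / 2)) => // x xe.
    apply: derivable_slice1; apply: diff_derivable; apply: (Ck_differentiable gC).
    exact: le_lt_trans xe e2.
  by rewrite derive_slice1; apply: bg => //; exact: Dr.
have lipI t q : `|t| <= e / 2 -> D q -> `|I t q - I 0 q| <= (C1 + C2) * `|t|.
  move=> te Dq; apply: le_trans (sqrt_sum_lipschitz _ _ _ _) _.
  rewrite mulrDl.
  exact: (lerD (lip P C1 t q PC bP te Dq) (lip Q C2 t q QC bQ te Dq)).
have bf t q : `|t| <= e / 2 -> D q -> `|f t q| <= 2 * (C1 + C2).
  move=> te Dq; have [->|t0] := eqVneq t 0.
    rewrite /f invr0 mulr0 normr0 mulr_ge0 //.
    have := lipI (e / 2) q; rewrite ger0_norm ?(ltW e20) // => /(_ (lexx _) Dq).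
    by move/(le_trans (normr_ge0 _)); rewrite pmulr_lge0.
  rewrite /f normrM normfV ler_pdivrMr ?normr_gt0 //.
  rewrite (_ : _ - _ = (I t q - I 0 q) + (I (- t) q - I 0 q)); last by ring.
  apply: le_trans (ler_normD _ _) _.
  rewrite -mulrA mulr_natl mulr2n; apply: lerD; first exact: lipI.
  by rewrite -[X in _ * X]normrN; apply: lipI; rewrite ?normrN.
have key := @continuity_under_integral R _ _ mu2 f D mD (- (e / 2)) (e / 2).
have in_itvE x : `](- (e / 2))%R, (e / 2)[%classic x -> `|x| < e / 2.
  by rewrite /= in_itv /= -ltr_norml.
(* Since f 0 = 0, continuity of the integral at time 0 is the claim. *)
have {key} : {for 0, continuous (fun t => \int[mu2]_(q in D) f t q)}.
  apply: (key _ _ (cst (2 * (C1 + C2)))).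
  - by move=> t /in_itvE te; apply: intf; exact: lt_trans te e2.
  - apply: (@filterS _ _ (ae_filter_ringOfSetsType mu2) _ _ _ ae_first_neq0).
    move=> q q0 Dq t /set_mem/in_itvE te.
    have te' := lt_trans te e2.
    have [->|t0] := eqVneq t 0.
      apply: second_difference_continuous.
      have p0 := pos q q0.
      have dP (g : R * R2 -> R) : Ck 1 U g -> differentiable (fun t => g (t, q)) 0.
        move=> gC; apply/derivable1_diffP; apply: derivable_slice1.
        apply: diff_derivable; apply: (Ck_differentiable gC).
        by rewrite /U /= normr0.
      apply/derivable1_diffP.
      apply: (@differentiable_comp _ _ _ _ (fun t => P (t, q) ^+ 2 + Q (t, q) ^+ 2) Num.sqrt).
        by apply: differentiableD; [exact: (differentiableM (dP _ PC) (dP _ PC))|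
          exact: (differentiableM (dP _ QC) (dP _ QC))].
      by apply/derivable1_diffP; have [] := is_derive1_sqrt p0.
    apply: cvgM; last by apply: cvgV.
    apply: cvgB; last by apply: cvg_cst.
    apply: cvgD; first exact: cIt.
    apply: (@continuous_comp _ _ _ (fun t => - t) (I ^~ q)); first exact: opp_continuous.
    by apply: cIt; rewrite normrN.
  - by apply: (continuous_integrable2 cD Dr) => q; exact: cvg_cst.
  - move=> t /in_itvE te; apply: aeW => q Dq /=; apply: bf => //; exact: ltW.
  - by rewrite inE /= in_itv /= oppr_lt0 e20.
rewrite /prop_for /continuous_at Ae ?normr0 // invr0 mulr0.
apply: cvg_trans; apply: near_eq_cvg; near=> t; apply: Ae.
near: t; exists e => //= t /=; by rewrite sub0r normrN.
Unshelve. all: by end_near. Qed.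

End SecondDifference.

(** * Derivatives at a minimum *)

Section Criterion.
Variable R : realType.

(** At a minimum both A(t) - A(0) and A(-t) - A(0) are nonnegative, so each of them is
    bounded by their sum. *)
Lemma minimum_is_derive (A : R -> R) (e : R) : 0 < e ->
  (forall t, `|t| < e -> A 0 <= A t) ->
  (A t + A (- t) - 2 * A 0) / t @[t --> 0] --> (0 : R) ->
  is_derive (0 : R) (1 : R) A 0.
Proof.
move=> e0 min sd.
have c : (fun h : R => h^-1 *: ((A \o shift 0) (h *: 1) - A 0)) @ 0^' --> (0 : R).
  apply/cvgrPdist_le => d d0; move/cvgrPdist_le : sd => /(_ _ d0) sd.
  have sd' : \forall t \near 0^', `|0 - (A t + A (- t) - 2 * A 0) / t| <= d.
    exact: nbhs_dnbhs sd.
  near=> t.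
  have te : `|t| < e.
    near: t; apply: nbhs_dnbhs; exists e => //= t /=; by rewrite sub0r normrN.
  have := near sd' t; rewrite !sub0r !normrN => H.
  apply: le_trans (H _); last by [].
  have m1 := min t te; have m2 := min (- t) (etrans (congr1 (fun x => x < e) (normrN t)) te).
  rewrite /GRing.scale /= mulr1 addr0 [leRHS]normrM mulrC normrM ler_wpM2r ?normr_ge0 //.
  rewrite ger0_norm ?subr_ge0 // ger0_norm; lra.
apply: DeriveDef; first by apply/cvg_ex; exists 0.
exact: cvg_lim c.
Unshelve. all: by end_near. Qed.

(** A negative second derivative would make A' negative just to the right of 0, and A
    would decrease there. *)
Lemma minimum_second_derivative_ge0 (A : R -> R) (e : R) : 0 < e ->
  (forall t, `|t| < e -> A 0 <= A t) -> is_derive (0 : R) (1 : R) A 0 ->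
  second_derivative_ge0 A.
Proof.
move=> e0 min dA.
have A'0 : derive1 A 0 = 0 by rewrite derive1E; exact: derive_val.
split.
  move=> nd d2; rewrite leNgt; apply/negP => neg.
  have neg' : 'D_1 (derive1 A) 0 < 0 by move: neg; rewrite derive1nS derive1n1 derive1E.
  pose c := - 'D_1 (derive1 A) 0.
  have c0 : 0 < c by rewrite oppr_gt0.
  have cv : (fun h : R => h^-1 *: ((derive1 A \o shift 0) (h *: 1) - derive1 A 0)) @ 0^'
     --> 'D_1 (derive1 A) 0 := d2.
  move/cvgrPdist_lt : cv => /(_ _ c0) [d1 /= d10 H1].
  move: nd => [d2' /= d20 H2].
  pose d := Num.min (Num.min d1 d2') e / 2.
  have m0 : 0 < Num.min (Num.min d1 d2') e by rewrite !lt_min d10 d20.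
  have d0 : 0 < d by rewrite divr_gt0.
  have : d < Num.min (Num.min d1 d2') e by rewrite ltr_pdivrMr // ltr_pMr // ltr1n.
  rewrite !lt_min => /andP[/andP[dd1 dd2] de].
  have small t : t \in `[0, d] -> derivable A t 1.
    rewrite in_itv /= => /andP[t0 td]; apply: H2.
    by rewrite /= sub0r normrN ger0_norm // (le_lt_trans td).
  have [||t] := @MVT _ A (derive1 A) 0 d d0.
  - move=> t /subset_itv_oo_cc td; rewrite derive1E; exact/derivableP/small.
  - by apply: derivable_within_continuous.
  rewrite in_itv /= => /andP[t0 td] E.
  have := min d; rewrite gtr0_norm // => /(_ de); rewrite -subr_ge0 E subr0 pmulr_lge0 //.
  have := H1 t; rewrite /= sub0r normrN gtr0_norm // => /(_ (lt_trans td dd1)).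
  rewrite gt_eqF // => /(_ isT); rewrite A'0 subr0 addr0 /GRing.scale /= mulr1 => H.
  have {H} : t^-1 * derive1 A t < 0.
    move: H; rewrite /c; set D := derive (derive1 A) 0 1; rewrite ltr_norml => /andP[+ _]; lra.
  by rewrite pmulr_rlt0 ?invr_gt0 // leNgt => ->.
rewrite /lower_second_derivative lime_infE; apply: le_trans (ereal_sup_ubound _).
  2: by exists e; rewrite //= in_itv /= e0.
rewrite leeNr oppe0; apply: ge_ereal_sup => _ [t [te _] <-].
rewrite /= lee_fin oppr_le0 A'0 mulr0 subr0 divr_ge0 ?sqr_ge0 // mulr_ge0 // subr_ge0.
by apply: min; move: te; rewrite /ball /= sub0r normrN.
Qed.

End Criterion.

(** * The horizontal frame and the ruled surface *)

Section Frame.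
Variable R : realType.
Local Notation R2 := (R * R)%type.
Local Notation R3 := (R * R * R)%type.
Local Notation "'e1'" := ((1, 0) : R2).
Local Notation "'e2'" := ((0, 1) : R2).

(** The decision procedure for fields sees sqrt 2 as an atom; this form of the goal
    makes both sides agree without the relation for its square. *)
Lemma sqrt2_cancel (u w : R) : u = 2 * w / (Num.sqrt 2 * Num.sqrt 2) -> u = w.
Proof. by rewrite sqrt2_sqr => ->; field. Qed.

Lemma co_frame (p : R3) (x y t : R) :
  let v := x *: frameX p + y *: frameY p + t *: frameT p in
  [/\ coX p v = x, coY p v = y & coT p v = t].
Proof.
move=> v; rewrite {}/v /coX /coY /coT /frameX /frameY /frameT /cx /cy /cz /=.
rewrite /GRing.scale /= expRN.
have s0 := sqrt2_neq0 R.
have e0 : expR p.2 != 0 by rewrite gt_eqF ?expR_gt0.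
by split; [ring|apply: sqrt2_cancel; field; rewrite s0 e0..].
Qed.

(** [normalX] and [normalY] are the components along X and Y of the normal vector
    a x b. *)
Definition normalX p a b : R := coY p a * coT p b - coT p a * coY p b.
Definition normalY p a b : R := coT p a * coX p b - coX p a * coT p b.

(** By Lagrange's identity the area element is the norm of a x b, which cancels the
    normalization of N.  Where a x b = 0 both sides vanish, the inverse of 0 being
    0. *)
Lemma horizontal_area (p a b : R3) :
  mnorm p (hproj p (unit_normal p a b)) * area_element p a b =
  Num.sqrt (normalX p a b ^+ 2 + normalY p a b ^+ 2).
Proof.
pose cT := coX p a * coY p b - coY p a * coX p b.
have [cX cY cT'] := co_frame p (normalX p a b) (normalY p a b) cT.
have {}cX : coX p (cross p a b) = normalX p a b by exact: cX.
have {}cY : coY p (cross p a b) = normalY p a b by exact: cY.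
have {cT'}cTE : coT p (cross p a b) = cT by exact: cT'.
have coZ k v : [/\ coX p (k *: v) = k * coX p v & coY p (k *: v) = k * coY p v].
  by rewrite /coX /coY /cx /cy /cz /= /GRing.scale /=; split; ring.
have mX v : metric p v (frameX p) = coX p v.
  have [+ + +] := co_frame p 1 0 0; rewrite !scale0r !addr0 scale1r /metric => -> -> ->.
  ring.
have mY v : metric p v (frameY p) = coY p v.
  have [+ + +] := co_frame p 0 1 0; rewrite !scale0r addr0 add0r scale1r /metric => -> -> ->.
  ring.
pose n2 := normalX p a b ^+ 2 + normalY p a b ^+ 2 + cT ^+ 2.
have nE : mnorm p (cross p a b) = Num.sqrt n2.
  by rewrite /mnorm /metric cX cY cTE /n2 !expr2.
have aE : area_element p a b = Num.sqrt n2.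
  rewrite /area_element; congr Num.sqrt.
  rewrite /n2 /normalX /normalY /cT /metric; ring.
have hE : mnorm p (hproj p (unit_normal p a b)) =
    (Num.sqrt n2)^-1 * Num.sqrt (normalX p a b ^+ 2 + normalY p a b ^+ 2).
  have [h1 h2 h3] := co_frame p ((Num.sqrt n2)^-1 * normalX p a b)
     ((Num.sqrt n2)^-1 * normalY p a b) 0.
  rewrite /hproj mX mY /unit_normal nE !(coZ _ _).1 !(coZ _ _).2 cX cY.
  move: h1 h2 h3; rewrite scale0r addr0 /mnorm /metric => -> -> ->.
  rewrite mulr0 addr0 -!expr2 !exprMn -mulrDr sqrtrM ?sqr_ge0 // sqrtr_sqr.
  by rewrite ger0_norm // invr_ge0 sqrtr_ge0.
rewrite hE aE; have [n0|n0] := eqVneq (Num.sqrt n2) 0; last by rewrite mulrAC mulVf // mul1r.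
rewrite n0 mulr0; apply/esym/eqP; rewrite sqrtr_eq0.
move/eqP: n0; rewrite sqrtr_eq0; apply: le_trans.
by rewrite /n2 lerDl sqr_ge0.
Qed.

(** The X-component of the normal is the Jacobian of the projection to the xy-plane:
    this is why the flux of X is the integral of dy /\ dx. *)
Lemma normalXE (p a b : R3) : normalX p a b = cy a * cx b - cx a * cy b.
Proof.
rewrite /normalX /coY /coT expRN.
have s0 := sqrt2_neq0 R.
have e0 : expR (cz p) != 0 by rewrite gt_eqF ?expR_gt0.
by apply: sqrt2_cancel; field; rewrite s0 e0.
Qed.

(** The point reached from (0, 0, z) by following Y for time s. *)
Definition ruling (q : R2) : R3 :=
  (- (q.1 * expR q.2) / Num.sqrt 2, q.1 * expR (- q.2) / Num.sqrt 2, q.2).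

Lemma Ck_ruling_comp (V : normedModType R) k (U : set V) (f : V -> R2) : open U ->
  Ck k U f -> Ck k U (fun x => ruling (f x)).
Proof.
move=> Uo fC; have C1 := Ck_fst Uo fC; have C2 := Ck_snd Uo fC.
apply: Ck_pair => //.
apply: Ck_pair => //; apply: CkM => //; try exact: Ck_cst.
  by apply: CkN => //; apply: CkM => //; exact: Ck_expR.
by apply: CkM => //; apply: Ck_expR => //; exact: CkN.
Qed.

Lemma Ck_ruling k (U : set R2) : open U -> Ck k U ruling.
Proof. by move=> Uo; apply: Ck_ruling_comp => //; exact: Ck_id. Qed.

Lemma derive_ruling (q v : R2) : 'D_v ruling q =
  (- (v.1 + q.1 * v.2) * expR q.2 / Num.sqrt 2,
   (v.1 - q.1 * v.2) * expR (- q.2) / Num.sqrt 2, v.2).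
Proof.
have oT : open [set: R2] by exact: openT.
have dF := Ck_differentiable (Ck_ruling 1 oT) (I : setT q).
have d1 : differentiable (fun q : R2 => q.1) q :=
  Ck_differentiable (@Ck_first _ _ 1 setT) I.
have d2 : differentiable (fun q : R2 => q.2) q :=
  Ck_differentiable (@Ck_second _ _ 1 setT) I.
have D1 : 'D_v (fun q : R2 => q.1) q = v.1.
  rewrite (derive_fst v (f := id)); last by [].
  by rewrite derive_id.
have D2 : 'D_v (fun q : R2 => q.2) q = v.2.
  rewrite (derive_snd v (f := id)); last by [].
  by rewrite derive_id.
have i1 : is_derive q v (fun q : R2 => q.1) v.1.
  by apply: DeriveDef => //; exact: diff_derivable.
have dE : differentiable (fun q : R2 => expR q.2) q :=
  Ck_differentiable (Ck_expR oT (@Ck_second _ _ 1 setT)) I.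
have dEN : differentiable (fun q : R2 => expR (- q.2)) q :=
  Ck_differentiable (Ck_expR oT (CkN oT (@Ck_second _ _ 1 setT))) I.
have iE : is_derive q v (fun q : R2 => expR q.2) (expR q.2 * v.2).
  apply: DeriveDef; first exact: diff_derivable.
  rewrite -[LHS]/('D_v (expR \o snd) q) (@derive_comp1 _ _ _ _ (expR q.2)) //.
  by rewrite -[X in _ * X = _]/('D_v (fun q : R2 => q.2) q) D2.
have iEN : is_derive q v (fun q : R2 => expR (- q.2)) (- expR (- q.2) * v.2).
  apply: DeriveDef; first exact: diff_derivable.
  rewrite -[LHS]/('D_v (expR \o (- (fun q : R2 => q.2))) q).
  rewrite (@derive_comp1 _ _ _ _ (expR (- q.2))) //; last exact: differentiableN.
  by rewrite deriveN ?D2 ?mulrN ?mulNr //; exact: diff_derivable.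
have dX := Ck_differentiable (Ck_fst oT (Ck_ruling 1 oT)) (I : setT q).
rewrite [LHS]surjective_pairing [X in (X, _)]surjective_pairing.
rewrite -!derive_snd // -!derive_fst // -?derive_snd // -?derive_fst //.
congr (_, _, _) => /=; last exact: D2.
- have := is_deriveM (is_deriveN (is_deriveM i1 iE)) (is_derive_cst ((Num.sqrt 2)^-1 : R) q v).
  case=> _ -> /=; rewrite /GRing.scale /=; ring.
- have := is_deriveM (is_deriveM i1 iEN) (is_derive_cst ((Num.sqrt 2)^-1 : R) q v).
  case=> _ -> /=; rewrite /GRing.scale /=; ring.
Qed.

Lemma ruling_immersion (q h : R2) : 'D_h ruling q = 0 -> h = 0.
Proof.
rewrite derive_ruling => -[/eqP + _ h2].
rewrite h2 mulr0 addr0 mulNr mulNr oppr_eq0 !mulf_eq0 invr_eq0.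
rewrite (negbTE (sqrt2_neq0 R)) (gt_eqF (expR_gt0 _)) !orbF => /eqP h1.
by move: h1 h2; case: h => h1 h2 /= -> ->.
Qed.

Definition ruling_inv (p : R3) : R2 := (Num.sqrt 2 * expR (cz p) * cy p, cz p).

Lemma rulingK : cancel ruling ruling_inv.
Proof.
case=> s z; congr (_, _); rewrite /cz /cy /= expRN.
by field; rewrite sqrt2_neq0 gt_eqF ?expR_gt0.
Qed.

Lemma range_ruling : range ruling = @Sigma R.
Proof.
apply/seteqP; split=> [_ [[s z] _ <-]|[[x y] z]]; rewrite /Sigma /cx /cy /cz /=.
  by rewrite expRN; field; rewrite sqrt2_neq0 gt_eqF ?expR_gt0.
move=> E; exists (Num.sqrt 2 * expR z * y, z) => //.
have z0 : expR z != 0 by rewrite gt_eqF ?expR_gt0.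
have xE : x = - (expR z ^+ 2 * y).
  have -> : x = expR z * (expR z * y + expR (- z) * x) - expR z ^+ 2 * y.
    by rewrite expRN; field.
  by rewrite E mulr0 sub0r.
rewrite /ruling /= xE expRN; congr (_, _, _); field; by rewrite ?sqrt2_neq0 ?z0.
Qed.

Lemma continuous_ruling_inv : continuous ruling_inv.
Proof.
move=> p; have oT : open [set: R3] by exact: openT.
have C2 : Ck 0 setT (fun p : R3 => p.2) := @Ck_second _ (R * R)%type 0 setT.
have C1 : Ck 0 setT (fun p : R3 => p.1.2) :=
  Ck_snd oT (Ck_fst oT (@Ck_id _ R3 0 setT)).
have C : Ck 0 setT (fun p : R3 => (Num.sqrt 2 * expR p.2 * p.1.2, p.2)) :=
  Ck_pair oT (CkM oT (CkM oT (Ck_cst _ _ _) (Ck_expR oT C2)) C1) C2.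
exact: (Ck_continuous C (I : setT p)).
Qed.

Lemma ruling_parametrizes : parametrizes ruling (@Sigma R).
Proof.
split.
- by apply: Ck_ruling; exact: openT.
- exact: ruling_immersion.
- exact: range_ruling.
- exists ruling_inv; split; first exact: rulingK.
  by apply: continuous_subspaceT; exact: continuous_ruling_inv.
Qed.

Lemma ruling_preimage (K : set R3) : compact K ->
  closed (ruling @^-1` K) /\ exists r, ruling @^-1` K `<=` box r.
Proof.
move=> cK; have oT : open [set: R2] by exact: openT.
have cF : continuous ruling by move=> q; exact: (Ck_continuous (Ck_ruling 0 oT)).
split.
  move/continuous_closedP : cF; apply; apply: compact_closed => //.
have : compact (ruling_inv @` K).
  by apply: continuous_compact => //; apply: continuous_subspaceT; exact: continuous_ruling_inv.
move/compact_bounded => [M [Mr KM]]; exists (M + 1) => q Kq.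
have := KM (M + 1); rewrite ltrDl ltr01 => /(_ isT q) H.
have : `|q| <= M + 1 by apply: H; exists (ruling q) => //; exact: rulingK.
by rewrite prod_normE ge_max => /andP[].
Qed.

Lemma normalX_ruling (q : R2) :
  normalX (ruling q) ('D_e1 ruling q) ('D_e2 ruling q) = - q.1.
Proof.
rewrite normalXE !derive_ruling /cx /cy /= expRN.
have s0 := sqrt2_neq0 R.
have z0 : expR q.2 != 0 by rewrite gt_eqF ?expR_gt0.
by apply: sqrt2_cancel; field; rewrite s0 z0.
Qed.

Lemma normalY_ruling (q : R2) :
  normalY (ruling q) ('D_e1 ruling q) ('D_e2 ruling q) = 0.
Proof.
rewrite /normalY !derive_ruling /coT /coX /cx /cy /cz /= expRN.
by field; rewrite sqrt2_neq0 gt_eqF ?expR_gt0.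
Qed.

(** Along Sigma, y - x = s (e^z + e^(- z)) / sqrt 2: it has the sign of s, and it
    dominates s because e^z + e^(- z) >= 2. *)
Lemma ruling_shear (q : R2) :
  0 <= q.1 * (cy (ruling q) - cx (ruling q)) /\
  `|q.1| <= `|cy (ruling q) - cx (ruling q)|.
Proof.
pose c := (expR q.2 + expR (- q.2)) / Num.sqrt 2.
have E : cy (ruling q) - cx (ruling q) = q.1 * c.
  by rewrite /cx /cy /ruling /c /=; ring.
have z0 := expR_gt0 q.2.
have c1 : 1 <= c.
  rewrite ler_pdivlMr ?sqrtr_gt0 // mul1r.
  apply: (@le_trans _ _ 2).
    by rewrite -[leRHS](@ger0_norm _ 2) // -sqrtr_sqr ler_wsqrtr // expr2; lra.
  have -> : expR q.2 + expR (- q.2) = 2 + (expR q.2 - 1) ^+ 2 / expR q.2.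
    by rewrite expRN; field; rewrite gt_eqF.
  by rewrite lerDl divr_ge0 ?sqr_ge0 // ltW.
have c0 : 0 <= c by exact: le_trans c1.
rewrite E; split; first by rewrite mulrA mulr_ge0 // -expr2 sqr_ge0.
by rewrite normrM (ger0_norm c0) ler_peMr.
Qed.

End Frame.

(** * Deformations of the ruled surface *)

Section Variation.
Variable R : realType.
Local Notation R2 := (R * R)%type.
Local Notation R3 := (R * R * R)%type.
Local Notation mu := (@lebesgue_measure R).
Local Notation mu2 := (mu \x mu)%E.
Local Notation "'e1'" := ((1, 0) : R2).
Local Notation "'e2'" := ((0, 1) : R2).

(** Time is a variable on a par with the parameters (s, z), so that regularity of the
    deformation is joint C^k regularity. *)
Definition deformed (phi : R -> R3 -> R3) (x : R * R2) : R3 := phi x.1 (ruling x.2).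

Definition deformed_normalX (phi : R -> R3 -> R3) (x : R * R2) : R :=
  normalX (deformed phi x) ('D_(0, e1) (deformed phi) x) ('D_(0, e2) (deformed phi) x).

Definition deformed_normalY (phi : R -> R3 -> R3) (x : R * R2) : R :=
  normalY (deformed phi x) ('D_(0, e1) (deformed phi) x) ('D_(0, e2) (deformed phi) x).

Variables (e : R) (K : set R3) (phi : R -> R3 -> R3).
Hypothesis phiV : compact_variation e K phi.

Let U : set (R * R2) := [set x | `|x.1| < e].

Let Uo : open U.
Proof.
have c : continuous (fun x : R * R2 => `|x.1|).
  by move=> x; apply: (@cvg_norm _ R^o); exact: cvg_fst.
move/continuousP : c => /(_ [set y : R | y < e]); apply; exact: open_lt.
Qed.

Lemma Ck_deformed : Ck 2 U (deformed phi).
Proof.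
have [_ _ phiC _ _] := phiV.
have V3o : open [set tp : R * R3 | `|tp.1| < e].
  have c : continuous (fun x : R * R3 => `|x.1|).
    by move=> x; apply: (@cvg_norm _ R^o); exact: cvg_fst.
  move/continuousP : c => /(_ [set y : R | y < e]); apply; exact: open_lt.
have fC : Ck 2 U (fun x : R * R2 => (x.1, ruling x.2)).
  apply: Ck_pair => //; first exact: Ck_first.
  by apply: Ck_ruling_comp => //; apply: Ck_snd => //; exact: Ck_id.
have fU x : U x -> [set tp : R * R3 | `|tp.1| < e] (x.1, ruling x.2) by [].
have C1 := Ck_comp Uo fU fC (Ck_fst V3o (Ck_fst V3o phiC)).
have C2 := Ck_comp Uo fU fC (Ck_snd V3o (Ck_fst V3o phiC)).
have C3 := Ck_comp Uo fU fC (Ck_snd V3o phiC).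
apply: (Ck_ext Uo _ (Ck_pair Uo (Ck_pair Uo C1 C2) C3)) => x _ /=.
by rewrite /deformed; case: (phi _ _) => [[]].
Qed.

Let Ck1_tangent v : Ck 1 U ('D_v (deformed phi)) := Ck_derive v Ck_deformed.

Lemma Ck_deformed_normalX : Ck 1 U (deformed_normalX phi).
Proof.
have X v := Ck_fst Uo (Ck_fst Uo (Ck1_tangent v)).
have Y v := Ck_snd Uo (Ck_fst Uo (Ck1_tangent v)).
have C := CkB Uo (CkM Uo (Y (0, e1)) (X (0, e2))) (CkM Uo (X (0, e1)) (Y (0, e2))).
by apply: (Ck_ext Uo _ C) => x _; rewrite /deformed_normalX normalXE.
Qed.

Lemma Ck_deformed_normalY : Ck 1 U (deformed_normalY phi).
Proof.
have X v := Ck_fst Uo (Ck_fst Uo (Ck1_tangent v)).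
have Y v := Ck_snd Uo (Ck_fst Uo (Ck1_tangent v)).
have Z v := Ck_snd Uo (Ck1_tangent v).
have z := Ck_snd Uo (CkW Ck_deformed).
have T v := CkM Uo (CkD Uo (CkM Uo (Ck_expR Uo (CkN Uo z)) (X v))
  (CkM Uo (Ck_expR Uo z) (Y v))) (@Ck_cst _ _ _ 1 U (Num.sqrt 2)^-1).
have C := CkB Uo (CkM Uo (T (0, e1)) (Z (0, e2))) (CkM Uo (Z (0, e1)) (T (0, e2))).
by apply: (Ck_ext Uo _ C).
Qed.

Let area t := (\int[mu2]_(q in @ruling R @^-1` K)
  Num.sqrt (deformed_normalX phi (t, q) ^+ 2 + deformed_normalY phi (t, q) ^+ 2))%R.

Lemma area_alongE t : area_along (@ruling R) K phi t = area t.
Proof.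
rewrite /area_along /subriemannian_area /area /Rintegral; congr fine.
apply: eq_integral => q _; rewrite /= horizontal_area.
rewrite /deformed_normalX /deformed_normalY.
by rewrite -!derive_slice2.
Qed.

Lemma deformed0 q : deformed phi (0, q) = ruling q.
Proof. by have [_ _ _ phi0 _] := phiV; exact: phi0. Qed.

Lemma deformed_normalX0 q : deformed_normalX phi (0, q) = - q.1.
Proof.
rewrite /deformed_normalX -!derive_slice2 deformed0.
by rewrite (_ : (fun s => deformed phi (0, s)) = @ruling R) ?normalX_ruling //;
  apply/funext => s; exact: deformed0.
Qed.

Lemma deformed_normalY0 q : deformed_normalY phi (0, q) = 0.
Proof.
rewrite /deformed_normalY -!derive_slice2 deformed0.
by rewrite (_ : (fun s => deformed phi (0, s)) = @ruling R) ?normalY_ruling //;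
  apply/funext => s; exact: deformed0.
Qed.

(** [calibration] applied to the coordinates x and y of the deformed surface, which
    change only where the ruled surface lies in K. *)
Lemma area_minimizing t : `|t| < e -> area 0 <= area t.
Proof.
move=> te; have [e0 cK phiC phi0 phiD] := phiV.
have [cD [r Dr]] := ruling_preimage cK.
have oT : open [set: R2] by exact: openT.
have slice (W : normedModType R) k (g : R * R2 -> W) u : `|u| < e -> Ck k U g ->
    Ck k setT (fun q => g (u, q)).
  by move=> ue gC; apply: Ck_sub (Ck_slice2 u gC) => q _.
have z : `|0 : R| < e by rewrite normr0.
have dC u (ue : `|u| < e) := slice _ _ _ _ ue Ck_deformed.
have XC u (ue : `|u| < e) := Ck_fst oT (Ck_fst oT (dC u ue)).
have YC u (ue : `|u| < e) := Ck_snd oT (Ck_fst oT (dC u ue)).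
have dd u (ue : `|u| < e) q := Ck_differentiable (dC u ue) (I : setT q).
have d1 u (ue : `|u| < e) q := Ck_differentiable (Ck_fst oT (dC u ue)) (I : setT q).
have jacE u (ue : `|u| < e) q : jac (fun q => cy (deformed phi (u, q)))
    (fun q => cx (deformed phi (u, q))) q = deformed_normalX phi (u, q).
  rewrite /deformed_normalX normalXE /jac -!derive_slice2.
  rewrite !(derive_fst _ (d1 u ue q)) !(derive_snd _ (d1 u ue q)).
  by rewrite !(derive_fst _ (dd u ue q)).
have off q : ~ (@ruling R @^-1` K) q -> deformed phi (t, q) = deformed phi (0, q).
  by move=> nq; rewrite deformed0 /deformed /= (phiD _ te).2.
have -> : area 0 = (\int[mu2]_(q in @ruling R @^-1` K) `|q.1|)%R.
  apply: eq_Rintegral => q _.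
  by rewrite deformed_normalX0 deformed_normalY0 sqrrN expr0n addr0 sqrtr_sqr.
apply: (@calibration _ _ _ _ _ _ _ r cD Dr (XC 0 z) (YC 0 z) (XC t te) (YC t te)).
- by move=> q /off ->.
- by move=> q /off ->.
- by move=> q; rewrite jacE // deformed_normalX0.
- by move=> q; rewrite deformed0; have [] := ruling_shear q.
- by move=> q; rewrite deformed0; have [] := ruling_shear q.
- move=> q.
  have cP := Ck_continuous (slice _ _ _ _ te Ck_deformed_normalX) (I : setT q).
  have cQ := Ck_continuous (slice _ _ _ _ te Ck_deformed_normalY) (I : setT q).
  apply: (@continuous_comp _ _ _ (fun q => deformed_normalX phi (t, q) ^+ 2 +
    deformed_normalY phi (t, q) ^+ 2) Num.sqrt); last exact: sqrt_continuous.
  by apply: cvgD; apply: cvgM.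
- by move=> q; rewrite jacE // -sqrtr_sqr ler_wsqrtr // lerDl sqr_ge0.
Qed.

Lemma area_along_is_derive : is_derive (0 : R) 1 (area_along (@ruling R) K phi) 0.
Proof.
have [e0 cK _ _ _] := phiV; have [cD [r Dr]] := ruling_preimage cK.
apply: (minimum_is_derive e0).
  by move=> t te; rewrite !area_alongE; exact: area_minimizing.
under [X in X @ _]eq_fun do rewrite !area_alongE.
apply: (@second_difference_cvg0 _ _ _ _ e r e0 Ck_deformed_normalX Ck_deformed_normalY cD Dr).
move=> q q0; rewrite deformed_normalX0 deformed_normalY0 sqrrN expr0n addr0.
by rewrite exprn_even_gt0.
Qed.

Lemma area_along_second_derivative : second_derivative_ge0 (area_along (@ruling R) K phi).
Proof.
have [e0 _ _ _ _] := phiV.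
apply: (minimum_second_derivative_ge0 e0) area_along_is_derive.
by move=> t te; rewrite !area_alongE; exact: area_minimizing.
Qed.

End Variation.

Theorem corollary5p8 (R : realType) : stable (@Sigma R).
Proof.
exists (@ruling R); split; first exact: ruling_parametrizes.
split=> e K phi phiV; first exact: area_along_is_derive phiV.
exact: area_along_second_derivative phiV.
Qed.
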